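(* The $C^{2,+}$ and $C^{2,\omega}$ versions of the Whitney extension theorem do not hold on any infinite-dimensional Banach space. More precisely: let $X$ be an infinite-dimensional Banach space. Then there are a closed set $E\subset B_X$ and a function $f\colon E\to\mathbb{R}$ such that for every $k\in\mathbb{N}$ and every non-trivial modulus $\omega$ there is $M>0$ such that $f$ satisfies condition $(W_{k,M\omega})$, but for every $r>1$ the function $f$ has no extension to a function from $C^{2,+}(U(0,r))$.
   Context: All normed linear spaces are real; derivatives are Fréchet derivatives; $\mathbb{N}=\{1,2,\dots\}$. $B_X$ is the closed unit ball of $X$ and $U(0,r)$ is the open ball in $X$ centred at $0$ with radius $r$. For $U\subset X$ open, $C^{2,+}(U)$ is the space of $C^2$-smooth functions $g\colon U\to\mathbb{R}$ whose second derivative is uniformly continuous on $U$. A modulus is a non-decreasing function $\omega\colon[0,+\infty)\to[0,+\infty]$ continuous at $0$ with $\omega(0)=0$; it is non-trivial if $\omega(t)>0$ for every $t>0$. For $j\in\mathbb{N}$, $\mathcal{L}^{\mathrm{s}}({}^{j}X;\mathbb{R})$ is the space of continuous symmetric $j$-linear forms on $X$ with the usual norm, and $\mathcal{L}^{\mathrm{s}}({}^{0}X;\mathbb{R})=\mathbb{R}$. For $N\in\mathcal{L}^{\mathrm{s}}({}^{n}X;\mathbb{R})$, $0\le l\le n$ and $u\in X$, $N[{}^{l}u,\cdot,\dots,\cdot]\in\mathcal{L}^{\mathrm{s}}({}^{n-l}X;\mathbb{R})$ denotes $N$ with $l$ of its arguments set equal to $u$. Condition $(W_{k,\omega})$ for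 $f\colon E\to\mathbb{R}$, $E\subset X$, $k\in\mathbb{N}$, $\omega$ a modulus: there exist mappings $f_j\colon E\to\mathcal{L}^{\mathrm{s}}({}^{j}X;\mathbb{R})$, $j=1,\dots,k$, such that, with $f_0=f$, for every $j\in\{0,\dots,k\}$ and all $x,y\in E$, $$\Bigl\|f_j(y)-\sum_{l=0}^{k-j}\frac1{l!}f_{j+l}(x)[{}^{l}(y-x),\cdot,\dots,\cdot]\Bigr\|\le\frac1{(k-j)!}\,\omega(\|y-x\|)\,\|y-x\|^{k-j}.$$ *)

(* Defs.v *)
From HB Require Import structures.
From mathcomp Require Import all_boot all_order all_algebra all_fingroup.
From mathcomp Require Import ring.
From mathcomp Require Import mathcomp_extra boolp classical_sets functions.
From mathcomp Require Import reals ereal topology normedtype landau derive.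
Set Implicit Arguments.
Unset Strict Implicit.
Unset Printing Implicit Defensive.
Import Order.TTheory GRing.Theory Num.Theory.
Import numFieldNormedType.Exports.
Local Open Scope classical_set_scope.
Local Open Scope ring_scope.

Definition infinite_dim (R : realType) (X : lmodType R) : Prop :=
  ~ exists (n : nat) (b : 'I_n -> X),
      forall x, exists c : 'I_n -> R, x = \sum_(i < n) c i *: b i.

Section Multilinear.
Variables (R : realType) (X : normedModType R).

Definition is_multilinear n (N : ('I_n -> X) -> R) : Prop :=
  forall (i : 'I_n) (v : 'I_n -> X), scalar (fun x => N (dfwith v i x)).

(* {ptws _ -> _} carries the product topology of X^n. *)
Definition mform_pred n : {pred ('I_n -> X) -> R} :=
  fun N => `[< is_multilinear N /\ continuous (N : {ptws 'I_n -> X} -> R) >].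

Record mform n := MForm {
  mform_fun :> ('I_n -> X) -> R;
  _ : mform_fun \in @mform_pred n }.

HB.instance Definition _ n := [isSub for @mform_fun n].
HB.instance Definition _ n := [Choice of mform n by <:].

Lemma mformP n (N : mform n) :
  is_multilinear N /\ continuous (N : {ptws 'I_n -> X} -> R).
Proof. by case: N => N /= /asboolP. Qed.

Lemma mform_submod_closed n : submod_closed (@mform_pred n).
Proof.
split=> [|a f g].
  apply/asboolP; split=> [i v b x y|v]; last exact: cst_continuous.
  by rewrite /= mulr0 addr0.
move=> /asboolP[lf cf] /asboolP[lg cg]; apply/asboolP; split=> [i v b x y|v].
  rewrite /= !fctE (lf i v b x y) (lg i v b x y) /=.
  set p := f _; set q := g _; set r := f _; set s := g _.
  rewrite /GRing.scale /=; ring.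
apply: (@continuousD _ _ {ptws 'I_n -> X} (a \*: (f : _ -> R)) g v); last exact: cg.
exact/continuousZl_tmp/cf.
Qed.

HB.instance Definition _ n := GRing.isSubmodClosed.Build R
  (('I_n -> X) -> R) (@mform_pred n) (@mform_submod_closed n).
HB.instance Definition _ n := [SubChoice_isSubLmodule of mform n by <:].

Lemma ptws_cvgP (I : Type) (F : set_system (I -> X)) (f : I -> X) :
  Filter F -> (forall i, (fun g => g i) @ F --> f i) -> {ptws, F --> f}.
Proof.
move=> FF Ff; apply/cvg_sup => i A /= [B [[C oC <-] Cf] CA].
apply: filterS CA _ => /=; apply: (Ff i).
exact: open_nbhs_nbhs.
Qed.

(* N [^l u, ., ..., .]; on symmetric forms the position of the u's is
   irrelevant. *)
Definition contr_arg j l (u : X) (v : 'I_j -> X) : 'I_(j + l) -> X :=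
  fun i => match fintype.split i with inl a => v a | inr _ => u end.

Lemma contr_subproof j l (u : X) (N : mform (j + l)) :
  (fun v => N (contr_arg u v)) \in @mform_pred j.
Proof.
have [lN cN] := mformP N; apply/asboolP; split=> [i v a x y|v].
  suff E z : contr_arg u (dfwith v i z) = dfwith (contr_arg u v) (lshift l i) z.
    by rewrite !E lN.
  apply/funext => k; rewrite /contr_arg; case: fintype.splitP => [a0 ka|b kb].
    have -> : k = lshift l a0 by apply: val_inj.
    case: (eqVneq i a0) => [->|ia]; first by rewrite !dfwithin.
    rewrite dfwithout // dfwithout ?eq_lshift //.
    by rewrite -/(unsplit (inl a0)) unsplitK.
  have -> : k = rshift j b by apply: val_inj.
  by rewrite dfwithout ?eq_lrshift // -/(unsplit (inr b)) unsplitK.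
apply: (@continuous_comp {ptws _ -> _} {ptws _ -> _} _ (@contr_arg j l u) N).
  apply: (@ptws_cvgP _ (@contr_arg j l u @ nbhs (v : {ptws _ -> _}))
            (contr_arg u v)) => i A /= vA.
  have [a ia|b ib] := fintype.splitP i; last first.
    have E w : contr_arg u w i = u.
      rewrite /contr_arg (_ : i = rshift j b); last exact: val_inj.
      by rewrite -/(unsplit (inr b)) unsplitK.
    rewrite E in vA.
    apply: (@filterS _ (nbhs (v : {ptws _ -> _})) _ setT); last exact: filterT.
    by move=> w _; rewrite /= E; exact: nbhs_singleton vA.
  have E w : contr_arg u w i = w a.
    rewrite /contr_arg (_ : i = lshift l a); last exact: val_inj.
    by rewrite -/(unsplit (inl a)) unsplitK.
  rewrite E in vA.
  apply: (@filterS _ (nbhs (v : {ptws _ -> _})) _ (proj a @^-1` A)).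
    by move=> w /=; rewrite /proj E.
  exact: (@proj_continuous _ (fun=> X) a v A vA).
exact: cN.
Qed.

Definition contr j l (u : X) (N : mform (j + l)) : mform j :=
  MForm (contr_subproof u N).

Definition mbox n : set ('I_n -> X) := [set v | forall i, `|v i| <= 1].

Definition mnorm n (N : mform n) : R := sup [set `|N v| | v in @mbox n].

Lemma mform_scale n (N : mform n) (c : R) (v : 'I_n -> X) :
  N (fun i => c *: v i) = c ^+ n * N v.
Proof.
have [lN _] := mformP N.
have H m : (m <= n)%N -> N (fun i : 'I_n => if (i < m)%N then c *: v i else v i)
    = c ^+ m * N v.
  elim: m => [_|m IH mn]; first by rewrite expr0 mul1r.
  pose i0 := Ordinal mn.
  pose w (i : 'I_n) := if (i < m)%N then c *: v i else v i.
  have -> : (fun i : 'I_n => if (i < m.+1)%N then c *: v i else v i) =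
      dfwith w i0 (c *: v i0 + 0).
    apply/funext => i; case: (eqVneq i0 i) => [<-|ii0].
      by rewrite dfwithin /= ltnSn addr0.
    rewrite dfwithout // /w ltnS leq_eqVlt.
    by have /negbTE -> : (val i != m) by apply: contraNneq ii0 => im; apply/eqP/val_inj.
  have L0 : N (dfwith w i0 0) = 0.
    have := lN i0 w 1 0 0; rewrite scaler0 addr0 mul1r => /eqP.
    by rewrite -subr_eq subrr eq_sym => /eqP.
  rewrite lN L0 addr0 exprS -mulrA -IH; last exact: ltnW.
  congr (_ * N _); apply/funext => i; case: (eqVneq i0 i) => [<-|ii0].
    by rewrite dfwithin /= ltnn.
  by rewrite dfwithout.
rewrite -(H n (leqnn n)); congr (N _); apply/funext => i.
by rewrite ltn_ord.
Qed.

Lemma mform_bounded n (N : mform n) :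
  exists M : R, forall v, mbox v -> `|N v| <= M.
Proof.
have [_ cN] := mformP N.
pose F : set_system ('I_n -> X) :=
  filter_from [set d : R | 0 < d] (fun d => [set v | forall i, `|v i| < d]).
have FF : Filter F.
  apply: filter_from_filter; first by exists 1; exact: ltr01.
  move=> d e /= d0 e0; exists (Num.min d e); first by rewrite /= lt_min d0.
  by move=> v /= H; split=> i; have := H i; rewrite lt_min => /andP[].
have F0 : {ptws, F --> (fun=> 0 : X)}.
  apply: ptws_cvgP => i A /= /nbhs_ballP[e /= e0 eA].
  exists e => // v /= vd; apply: eA.
  by rewrite -ball_normE /= sub0r normrN.
have [|d /= d0 dN] := F0 [set v | `|N (fun=> 0) - N v| < 1].
  have /= := cN (fun=> 0) (ball (N (fun=> 0)) 1).
  rewrite -ball_normE; apply.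
  by rewrite ball_normE; apply: nbhsx_ballx.
exists ((`|N (fun=> 0)| + 1) / (d / 2) ^+ n) => v vb.
have c0 : 0 < d / 2 by rewrite divr_gt0.
rewrite ler_pdivlMr ?exprn_gt0 // -[X in _ * X]gtr0_norm ?exprn_gt0 //.
rewrite -normrM mulrC -mform_scale.
have /ltW H : `|N (fun=> 0) - N (fun i => (d / 2) *: v i)| < 1.
  apply: dN => i; rewrite normrZ gtr0_norm //.
  apply: (@le_lt_trans _ _ (d / 2)); first by rewrite ler_piMr // ltW.
  by rewrite ltr_pdivrMr // ltr_pMr // ltr1n.
by rewrite -lerBlDl (le_trans (lerB_dist _ _)) // distrC.
Qed.

Lemma mnorm_has_sup n (N : mform n) : has_sup [set `|N v| | v in @mbox n].
Proof.
split; first by exists `|N (fun=> 0)|, (fun=> 0) => // i; rewrite normr0.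
by have [M MN] := mform_bounded N; exists M => _ [v vb <-]; exact: MN.
Qed.

Lemma le_mnorm_box n (N : mform n) v : mbox v -> `|N v| <= mnorm N.
Proof.
by move=> vb; apply: ub_le_sup; [have [] := mnorm_has_sup N | exists v].
Qed.

Lemma mnorm_le n (N : mform n) M :
  (forall v, mbox v -> `|N v| <= M) -> mnorm N <= M.
Proof.
move=> H; apply: ge_sup; first by have [] := mnorm_has_sup N.
by move=> _ [v vb <-]; exact: H.
Qed.

Lemma mnormD n (N P : mform n) : mnorm (N + P) <= mnorm N + mnorm P.
Proof.
apply: mnorm_le => v vb; apply: le_trans (ler_normD _ _) _.
by rewrite lerD ?le_mnorm_box.
Qed.

Lemma mnormZ n a (N : mform n) : mnorm (a *: N) = `|a| * mnorm N.
Proof.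
have H b (P : mform n) : mnorm (b *: P) <= `|b| * mnorm P.
  apply: mnorm_le => v vb; rewrite [X in `|X|]/(b * P v) normrM.
  by rewrite ler_wpM2l ?le_mnorm_box.
have [->|a0] := eqVneq a 0.
  apply/eqP; rewrite eq_le H normr0 mul0r /=.
  apply: le_trans (normr_ge0 _) (@le_mnorm_box n _ (fun=> 0) _) => i.
  by rewrite normr0.
apply/eqP; rewrite eq_le H /= -ler_pdivlMl ?normr_gt0 // -normfV.
by have := H a^-1 (a *: N); rewrite scalerA mulVf // scale1r.
Qed.

Lemma mnorm_eq0 n (N : mform n) : mnorm N = 0 -> N = 0.
Proof.
move=> N0; apply/val_inj/funext => v /=.
pose c := (1 + \sum_i `|v i|)^-1.
have s0 : 0 < 1 + \sum_i `|v i| by rewrite ltr_wpDr // sumr_ge0.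
have c0 : 0 < c by rewrite invr_gt0.
have : `|N (fun i => c *: v i)| <= mnorm N.
  apply: le_mnorm_box => i; rewrite normrZ gtr0_norm // /c mulrC ler_pdivrMr // mul1r.
  by rewrite (bigD1 i) //= addrCA lerDl addr_ge0 // sumr_ge0.
rewrite N0 normr_le0 mform_scale mulf_eq0 expf_eq0 gt_eqF // andbF /=.
by move=> /eqP.
Qed.

HB.instance Definition _ n := Lmodule_isNormed.Build R (mform n)
  (@mnormD n) (@mnormZ n) (@mnorm_eq0 n).

Lemma mform_normE n (N : mform n) : `|N| = mnorm N.
Proof. by []. Qed.

Definition msymmetric n (N : mform n) : Prop :=
  forall (s : 'S_n) (v : 'I_n -> X), N (v \o s) = N v.

(* D1 and D2 are the first two Frechet derivatives of g on U, with
   L(X; L(X; R)) identified with the bilinear forms, the direction of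
   differentiation being the last argument. *)
Definition C2_on (U : set X) (g : X -> R) (D1 : X -> mform 1) (D2 : X -> mform 2)
    : Prop :=
  forall x, U x ->
  [/\ differentiable g x,
      forall h, 'd g x h = D1 x (fun=> h),
      differentiable D1 x,
      forall h, 'd D1 x h = contr h (D2 x : mform (1 + 1)) &
      {for x, continuous D2}].

Definition C2plus (U : set X) (g : X -> R) : Prop :=
  exists D1 D2, C2_on U g D1 D2 /\
    forall e : R, 0 < e -> exists2 d : R, 0 < d &
      forall x y, U x -> U y -> `|x - y| < d -> `|D2 x - D2 y| < e.

End Multilinear.

(* Only the values of omega on [0, +oo[ are constrained. *)
Definition is_modulus (R : realType) (omega : R -> \bar R) : Prop :=
  [/\ omega 0 = 0%E,
      forall t, 0 <= t -> (0 <= omega t)%E,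
      forall s t, 0 <= s -> s <= t -> (omega s <= omega t)%E &
      omega t @[t --> within [set t | 0 <= t] (nbhs (0 : R))] --> omega 0].

Definition nontrivial_modulus (R : realType) (omega : R -> \bar R) : Prop :=
  is_modulus omega /\ forall t, 0 < t -> (0 < omega t)%E.

(* Functions on E are total functions of which only the values on E matter;
   elements of L^s(^0 X; R) are the forms in 0 variables. *)
Definition W_cond (R : realType) (X : normedModType R) (k : nat)
    (omega : R -> \bar R) (E : set X) (f : X -> R) : Prop :=
  exists f_ : forall j, X -> mform X j,
  [/\ forall x v, E x -> f_ 0 x v = f x,
      forall j x, (j <= k)%N -> E x -> msymmetric (f_ j x) &
      forall j x y, (j <= k)%N -> E x -> E y ->
        let rem := f_ j y - \sum_(l < (k - j).+1)
          (l`!%:R)^-1 *: contr (y - x) (f_ (j + l)%N x) in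
        (`|rem|%:E <= ((k - j)`!%:R^-1)%:E * omega `|y - x|%R
                      * (`|y - x| ^+ (k - j))%:E)%E].

(* Main.v *)
From HB Require Import structures.
Require Import Defs.
From mathcomp Require Import all_boot all_order all_algebra all_fingroup.
From mathcomp Require Import ring lra zify.
From mathcomp Require Import boolp classical_sets functions cardinality reals ereal.
From mathcomp Require Import topology normedtype sequences derive.
Import Order.TTheory GRing.Theory Num.Theory.
Import numFieldNormedType.Exports.
Local Open Scope classical_set_scope.
Local Open Scope ring_scope.
Set Implicit Arguments.
Unset Strict Implicit.
Unset Printing Implicit Defensive.

(* A function [f] with uniformly continuous second derivative cannot tell apart
   two random walks with small symmetric steps whose covariances agree: at each
   step of size [delta] the two averages of [f] differ by [o(delta ^ 2)], so the
   total difference is small as long as the sum of the squared step sizes stays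
   bounded.  The two walks used here have, in their [j]-th stage, the steps
   [±5 v0, ±5 v1], respectively [±(3 v0 + 4 v1), ±(4 v0 - 3 v1)], where [v0] and
   [v1] are new vectors for every stage.  If the vectors behave like an
   orthonormal family, the endpoints of the two walks are far apart, so the
   function equal to 0 on the endpoints of the first walk and to 1 on those of
   the second one is locally constant (and satisfies the Whitney conditions with
   zero derivatives) but has no C^{2,+} extension.  The set E is a union of such
   blocks, with more and more stages, placed far from each other.

   Suitable vectors exist in every infinite-dimensional space by a weak form of
   Dvoretzky's theorem.  A determinant maximisation (Dvoretzky-Rogers) yields
   operators from Euclidean spaces of norm 1 that map each basis vector to a
   vector of norm at least 1/3; their Rademacher averages, after each vector is
   repeated with independent signs, are arbitrarily large.  By a Poincaré
   inequality on the discrete cube the norm of a Rademacher sum has bounded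
   variance, so it is concentrated, and independent copies of that sum have the
   required behaviour for any prescribed finite set of coefficients. *)

(** * Riesz sequences *)

Section Riesz.
Variables (R : realType) (X : normedModType R).
Implicit Types (e : nat -> X) (c : nat -> R) (x : X).

(** The vector [x] has distance at least 1/2 from the span of the first [n] vectors. Coefficients
    are indexed by [nat] so that one family serves for every [n]. *)
Definition separated_from e n x :=
  forall c, 2^-1 <= `|x - \sum_(i < n) c i *: e i|.

Lemma separated_coef e n x c (a : R) : separated_from e n x ->
  `|a| / 2 <= `|\sum_(i < n) c i *: e i + a *: x|.
Proof.
move=> sx; have [->|a0] := eqVneq a 0; first by rewrite normr0 mul0r.
have -> : \sum_(i < n) c i *: e i + a *: x =
    a *: (x - \sum_(i < n) (- (c i / a)) *: e i).
  rewrite scalerBr addrC; congr (_ + _).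
  rewrite scaler_sumr -sumrN; apply: eq_bigr => i _.
  by rewrite scalerA -scaleNr; congr (_ *: _); field.
by rewrite normrZ ler_wpM2l // (sx (fun i => - (c i / a))).
Qed.

(** Completeness of [X] is avoided: by [separated_coef] the last coefficients of the approximants
    form a Cauchy sequence of reals. Their limit gives the coefficient of [e n], and induction
    handles the rest. *)
Lemma separated_span_closed e n x :
  (forall k, (k < n)%N -> separated_from e k (e k)) ->
  (forall eps : R, 0 < eps -> exists c, `|x - \sum_(i < n) c i *: e i| < eps) ->
  exists c, x = \sum_(i < n) c i *: e i.
Proof.
elim: n x => [|n IH] x sep apx.
  exists (fun=> 0); apply/eqP; rewrite big_ord0 -normr_eq0 eq_le normr_ge0 andbT.
  by apply/ler_addgt0Pr => eps /apx[c]; rewrite big_ord0 subr0 add0r => /ltW.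
have /choice[c cP] k : exists c, `|x - \sum_(i < n.+1) c i *: e i| < (k.+1%:R)^-1.
  by apply: apx; rewrite invr_gt0.
have close k l : `|c k n - c l n| <= 2 * ((k.+1%:R)^-1 + (l.+1%:R)^-1).
  have := @separated_coef e n (e n) (fun i => c k i - c l i) (c k n - c l n)
    (sep n (ltnSn n)).
  have -> : \sum_(i < n) (c k i - c l i) *: e i + (c k n - c l n) *: e n =
     (x - \sum_(i < n.+1) c l i *: e i) - (x - \sum_(i < n.+1) c k i *: e i).
    rewrite opprB addrACA [- _ + _ in RHS]addrC addrACA addrC !big_ord_recr /=.
    under eq_bigr do rewrite scalerBl.
    rewrite sumrB scalerBl subrr addr0 opprD.
    by rewrite addrACA.
  have := ler_normB (x - \sum_(i < n.+1) c l i *: e i) (x - \sum_(i < n.+1) c k i *: e i).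
  have := cP k; have := cP l.
  move: (k.+1%:R^-1) (l.+1%:R^-1) => u v; lra.
have /cvg_ex[/= a ca] : cvgn (fun k => c k n).
  apply/cauchy_cvgP/cauchyP => eps eps0.
  have e4 : 0 < eps / 8 by rewrite divr_gt0.
  have [N _ HN] := near_infty_natSinv_lt (PosNum e4).
  exists (c N n); exists N => // k /= Nk; rewrite -ball_normE /=.
  apply: le_lt_trans (close _ _) _.
  have /= := HN N (leqnn N); have /= := HN k Nk.
  by move: (k.+1%:R^-1) (N.+1%:R^-1) => u v; lra.
have apx' (eps : R) : 0 < eps ->
    exists c', `|x - a *: e n - \sum_(i < n) c' i *: e i| < eps.
  move=> eps0.
  have e0 : 0 < eps / 2 / (`|e n| + 1) by rewrite !divr_gt0 // ltr_wpDl.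
  have /cvgrPdist_lt/(_ _ e0) near_a := ca.
  have near_inv : \forall k \near \oo, (k.+1%:R)^-1 < eps / 2 :> R.
    by apply: near_infty_natSinv_lt (PosNum _); rewrite divr_gt0.
  have [k [ka ki]] := filter_ex (filterI near_a near_inv).
  exists (c k).
  have -> : x - a *: e n - \sum_(i < n) c k i *: e i =
      (x - \sum_(i < n.+1) c k i *: e i) - (a - c k n) *: e n.
    by rewrite big_ord_recr /= scalerBl !opprD !opprK !addrA [RHS]addrAC subrK addrAC.
  apply: le_lt_trans (ler_normB _ _) _; rewrite normrZ.
  have : `|a - c k n| * `|e n| <= eps / 2.
    apply: (@le_trans _ _ (eps / 2 / (`|e n| + 1) * (`|e n| + 1))).
      by apply: ler_pM => //; [exact: ltW|rewrite lerDl].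
    by rewrite divfK // gt_eqF // ltr_wpDl.
  by have := cP k; move: ki => /=; move: (k.+1%:R^-1) => u; lra.
have [c' c'E] := IH _ (fun k kn => sep k (ltnW kn)) apx'.
exists (fun i => if (i < n)%N then c' i else a); rewrite big_ord_recr /= ltnn.
under eq_bigr do rewrite ltn_ord.
by rewrite -c'E subrK.
Qed.

(** Riesz's lemma. The span is proper and closed, so some [x] lies at positive distance from it;
    subtracting an almost nearest point and normalising gives the vector. *)
Lemma separated_vector e n : infinite_dim X ->
  (forall k, (k < n)%N -> separated_from e k (e k)) ->
  exists x, `|x| = 1 /\ separated_from e n x.
Proof.
move=> hX sep.
have [x xN] : exists x, ~ exists c, x = \sum_(i < n) c i *: e i.
  apply: contrapT => /forallNP H; apply: hX; exists n, (fun i => e i) => x.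
  by have /contrapT[c ->] := H x; exists (fun i => c i).
have [d d0 dP] : exists2 d : R, 0 < d &
    forall c, d <= `|x - \sum_(i < n) c i *: e i|.
  apply: contrapT => H; apply: xN; apply: separated_span_closed => // d d0.
  apply: contrapT => /forallNP H'; apply: H; exists d => // c.
  by rewrite leNgt; apply/negP/H'.
pose S : set R := [set `|x - \sum_(i < n) c i *: e i| | c in [set: nat -> R]].
have infS : has_inf S.
  split; first by exists `|x - \sum_(i < n) (fun=> 0) i *: e i|; exists (fun=> 0).
  by exists d => _ [c _ <-]; exact: dP.
have dinf : d <= inf S by apply: lb_le_inf; [case: infS|move=> _ [c _ <-]; exact: dP].
have i0 : 0 < inf S := lt_le_trans d0 dinf.
have [_ [c _ <-]] := inf_adherent i0 infS.
(* The tolerance is [inf S] itself, so [y] is shorter than twice the distance; this is where 1/2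
   comes from. *)
rewrite -mulr2n => cP; set y := x - _ in cP.
have y0 : 0 < `|y| by apply: lt_le_trans d0 _; exact: dP.
exists (`|y|^-1 *: y); split.
  by rewrite normrZ gtr0_norm ?invr_gt0 // mulVf // gt_eqF.
move=> c'.
have -> : `|y|^-1 *: y - \sum_(i < n) c' i *: e i =
    `|y|^-1 *: (x - \sum_(i < n) (c i + `|y| * c' i) *: e i).
  under [X in _ = _ *: (x - X)]eq_bigr do rewrite scalerDl -scalerA.
  rewrite big_split /= -scaler_sumr opprD addrA -/y [RHS]scalerBr scalerA mulVf ?scale1r//.
  by rewrite gt_eqF.
rewrite normrZ gtr0_norm ?invr_gt0 // mulrC ler_pdivlMr // mulrC ler_pdivrMr //.
apply: le_trans (ltW cP) _; rewrite mulr_natr lerMn2r /=.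
by apply: ge_inf; [case: infS|exists (fun i => c i + `|y| * c' i)].
Qed.

Lemma separated_sequence : infinite_dim X ->
  exists e, forall n, `|e n| = 1 /\ separated_from e n (e n).
Proof.
move=> hX.
(* The next vector depends on all previous ones, hence a choice function on lists; its value on
   lists that are not separated is a dummy. *)
have /choice[nx nxP] (s : seq X) : exists x,
    (forall k, (k < size s)%N -> separated_from (nth 0 s) k (nth 0 s k)) ->
    `|x| = 1 /\ separated_from (nth 0 s) (size s) x.
  have [H|H] := pselect (forall k, (k < size s)%N ->
    separated_from (nth 0 s) k (nth 0 s k)); last by exists 0.
  by have [x xP] := separated_vector hX H; exists x.
pose s n := iter n (fun s => rcons s (nx s)) [::].
have ss n : size (s n) = n by elim: n => //= n IH; rewrite size_rcons IH.
pose e n := nx (s n).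
have se n k : (k < n)%N -> nth 0 (s n) k = e k.
  elim: n => // n IH; rewrite ltnS leq_eqVlt /= nth_rcons ss => /orP[/eqP ->|kn].
    by rewrite ltnn eqxx.
  by rewrite kn IH.
have sepE n x : separated_from (nth 0 (s n)) n x -> separated_from e n x.
  move=> H c; have := H c.
  by under eq_bigr => i _ do rewrite (se _ _ (ltn_ord i)).
have sepE' n k x : (k < n)%N -> separated_from e k x -> separated_from (nth 0 (s n)) k x.
  move=> kn H c; have := H c.
  by under [X in _ -> _ <= `|_ - X|]eq_bigr => i _ do
    rewrite (se _ _ (ltn_trans (ltn_ord i) kn)).
exists e => n; elim/ltn_ind: n => n IH.
have [] := nxP (s n); first rewrite ss => k kn.
  by rewrite se //; apply: sepE' => //; have [] := IH _ kn.
by rewrite ss => e1 /sepE.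
Qed.
End Riesz.

(** * The Dvoretzky-Rogers lemma *)

(** Sylvester's identity: one block matrix is factored into block triangular matrices in two
    ways. *)
Lemma det_addmx_mulmxC (K : comNzRingType) m n (A : 'M[K]_(m, n)) (B : 'M[K]_(n, m)) :
  \det (1%:M + A *m B) = \det (1%:M + B *m A).
Proof.
have E : block_mx 1%:M A (- B) 1%:M =
    block_mx 1%:M A 0 1%:M *m block_mx (1%:M + A *m B) 0 (- B) 1%:M.
  by rewrite mulmx_block !mul1mx !mulmx1 !mul0mx !add0r mulmxN addrK.
have F : block_mx 1%:M A (- B) 1%:M =
    block_mx 1%:M 0 (- B) 1%:M *m block_mx 1%:M A 0 (1%:M + B *m A).
  by rewrite mulmx_block !mul1mx !mulmx1 !mul0mx !addr0 mulNmx addrC addrK.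
have := congr1 determinant (etrans (esym E) F).
by rewrite !det_mulmx !det_ublock !det_lblock !det1 !mul1r mulr1.
Qed.

Section DvoretzkyRogers.
Variables (R : realType) (X : normedModType R).

Definition l2 n (a : 'rV[R]_n) : R := Num.sqrt (\sum_i a 0 i ^+ 2).

Lemma l2E n (a : 'rV[R]_n) : l2 a ^+ 2 = \sum_i a 0 i ^+ 2.
Proof. by rewrite sqr_sqrtr // sumr_ge0 // => i _; rewrite sqr_ge0. Qed.

Lemma l2_mulE n (a : 'rV[R]_n) : l2 a ^+ 2 = (a *m a^T) 0 0.
Proof. by rewrite l2E mxE; apply: eq_bigr => i _; rewrite mxE expr2. Qed.

Lemma l2_ge0 n (a : 'rV[R]_n) : 0 <= l2 a. Proof. exact: sqrtr_ge0. Qed.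

Lemma l2Z n (a : 'rV[R]_n) (c : R) : l2 (c *: a) = `|c| * l2 a.
Proof.
rewrite /l2; under eq_bigr do rewrite mxE exprMn.
by rewrite -mulr_sumr sqrtrM ?sqr_ge0 // sqrtr_sqr.
Qed.

Lemma le_coord_l2 n (a : 'rV[R]_n) i : `|a 0 i| <= l2 a.
Proof.
rewrite -(ler_pXn2r (ltn0Sn 1)) ?nnegrE ?l2_ge0 // l2E real_normK ?num_real //.
by rewrite (bigD1 i) //= lerDl sumr_ge0 // => j _; rewrite sqr_ge0.
Qed.

Lemma l2_eq0 n (a : 'rV[R]_n) : l2 a = 0 -> a = 0.
Proof.
move=> a0; apply/rowP => i; rewrite mxE; apply/eqP.
by rewrite -normr_le0 -a0 le_coord_l2.
Qed.

Lemma l2_orthonormal k n (Q : 'M[R]_(k, n)) (a : 'rV_k) :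
  Q *m Q^T = 1%:M -> l2 (a *m Q) = l2 a.
Proof.
move=> QQ; apply/eqP; rewrite -(@eqrXn2 _ 2) ?l2_ge0 //.
by rewrite !l2_mulE trmx_mul mulmxA -(mulmxA a) QQ mulmx1.
Qed.

(** The residual [b] is orthogonal to the rows of [Q], so its square is [b *m a^T], which is the
    square of [a] minus that of [a *m Q^T]. *)
Lemma l2_orthogonal_part k n (Q : 'M[R]_(k, n)) (a : 'rV_n) :
  Q *m Q^T = 1%:M -> l2 (a - a *m Q^T *m Q) <= l2 a.
Proof.
move=> QQ; rewrite -(ler_pXn2r (ltn0Sn 1)) ?nnegrE ?l2_ge0 //.
rewrite [X in X <= _]l2_mulE; set b := _ - _.
have bQ : b *m Q^T = 0.
  by rewrite mulmxBl -(mulmxA _ Q) QQ mulmx1 subrr.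
have -> : b *m b^T = b *m a^T.
  by rewrite [in X in _ *m X]/b raddfB /= trmx_mul mulmxBr [X in _ - X]mulmxA bQ mul0mx subr0.
rewrite /b mulmxBl mxE -l2_mulE mxE lerBlDr lerDl.
by rewrite -(mulmxA _ Q) (_ : Q *m a^T = (a *m Q^T)^T) -?l2_mulE ?sqr_ge0 // trmx_mul trmxK.
Qed.

Variable e : nat -> X.
Hypothesis eP : forall n, `|e n| = 1 /\ separated_from e n (e n).

Definition comb n (c : 'rV[R]_n) : X := \sum_(i < n) c 0 i *: e i.

Lemma combD n (c d : 'rV[R]_n) : comb (c + d) = comb c + comb d.
Proof. by rewrite -big_split; apply: eq_bigr => i _; rewrite mxE scalerDl. Qed.

Lemma combZ n a (c : 'rV[R]_n) : comb (a *: c) = a *: comb c.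
Proof. by rewrite scaler_sumr; apply: eq_bigr => i _; rewrite mxE scalerA. Qed.

(** By [separated_coef] the last coefficient is at most twice the norm of the sum; removing its term
    leaves a sum at most three times as large, to which induction applies. *)
Lemma comb_coord_bound n : exists2 B : R, 0 <= B &
  forall (c : nat -> R) i, (i < n)%N -> `|c i| <= B * `|\sum_(i < n) c i *: e i|.
Proof.
elim: n => [|n [B B0 IH]]; first by exists 0.
exists (2 + 3 * B) => [|c i]; first by rewrite addr_ge0 // mulr_ge0.
have := @separated_coef _ _ e n (e n) c (c n) (proj2 (eP n)).
rewrite big_ord_recr /=; set S := _ + _ => cn.
have S0 : 0 <= `|S| by [].
have S3 : `|\sum_(i < n) c i *: e i| <= 3 * `|S|.
  have -> : \sum_(i < n) c i *: e i = S - c n *: e n by rewrite addrK.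
  apply: le_trans (ler_normB _ _) _; rewrite normrZ (proj1 (eP n)) mulr1; lra.
have BS : 0 <= B * `|S| by rewrite mulr_ge0.
rewrite ltnS leq_eqVlt => /orP[/eqP ->|/IH]; first by rewrite mulrDl -mulrA; lra.
move=> /(_ c)/le_trans; apply; apply: le_trans (ler_wpM2l B0 S3) _.
by rewrite mulrDl; lra.
Qed.

(** The matrix [V] encodes an operator of norm at most 1 from Euclidean space to the span of the
    first [n] vectors of [e]. *)
Definition contractive n (V : 'M[R]_n) := forall a, `|comb (a *m V)| <= l2 a.

Lemma contractive_det_bound n : exists K : R,
  forall V : 'M[R]_n, contractive V -> \det V <= K.
Proof.
have [B B0 HB] := comb_coord_bound n.
exists (\sum_(s : 'S_n) B ^+ n) => V cV.
have HV i j : `|V i j| <= B.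
  have := cV (delta_mx 0 i); rewrite -rowE.
  have -> : l2 (delta_mx 0 i) = 1.
    rewrite /l2 (bigD1 i) //= big1 => [|k ki]; rewrite !mxE ?eqxx ?expr1n ?addr0 ?sqrtr1 //.
    by rewrite (negbTE ki) andbF expr0n.
  (* Row [i] extended by zero, since [comb_coord_bound] takes families indexed by [nat]. *)
  pose c k := if insub k is Some k' then V i k' else 0.
  have cE (k : 'I_n) : c k = V i k by rewrite /c valK.
  rewrite -cE => H; apply: le_trans (HB c j (ltn_ord j)) _.
  rewrite ler_piMr //; apply: le_trans H.
  by rewrite le_eqVlt (_ : comb _ = \sum_(i < n) c i *: e i) ?eqxx //;
     apply: eq_bigr => k _; rewrite cE mxE.
apply: ler_sum => s _; apply: le_trans (ler_norm _) _.
rewrite normrM normrX normrN1 expr1n mul1r normr_prod.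
by rewrite -[n in leRHS]card_ord -prodr_const; apply: ler_prod => i _; rewrite normr_ge0 HV.
Qed.

Lemma contractive_scalar n : contractive ((n.+1%:R)^-1%:M : 'M[R]_n).
Proof.
move=> a; rewrite mul_mx_scalar combZ normrZ gtr0_norm ?invr_gt0 ?ltr0n //.
rewrite mulrC ler_pdivrMr ?ltr0n //; apply: le_trans (ler_norm_sum _ _ _) _.
apply: (@le_trans _ _ (\sum_(i < n) l2 a)).
  by apply: ler_sum => i _; rewrite normrZ (proj1 (eP i)) mulr1 le_coord_l2.
by rewrite sumr_const card_ord -[l2 a *+ n]mulr_natr ler_wpM2l ?l2_ge0 // ler_nat.
Qed.

(** A maximum up to the factor 2 suffices later and needs only the supremum, not compactness. *)
Lemma contractive_almost_max n : exists V : 'M[R]_n, [/\ contractive V,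
  0 < \det V & forall W : 'M[R]_n, contractive W -> \det W < 2 * \det V].
Proof.
pose S : set R := [set \det V | V in @contractive n].
have [K HK] := contractive_det_bound n.
have d0 : 0 < \det ((n.+1%:R)^-1%:M : 'M[R]_n).
  by rewrite det_scalar exprn_gt0 // invr_gt0 ltr0n.
have supS : has_sup S.
  split; first by eexists; exists (n.+1%:R^-1%:M) => //; exact: contractive_scalar.
  by exists K => _ [V cV <-]; exact: HK.
have s0 : 0 < sup S.
  apply: lt_le_trans d0 _; apply: sup_ubound; first by case: supS.
  by exists (n.+1%:R^-1%:M) => //; exact: contractive_scalar.
have [_ [V cV <-] HV] := sup_adherent (divr_gt0 s0 (ltr0n _ 2)) supS.
exists V; split => // [|W cW]; first lra.
have : \det W <= sup S by apply: sup_ubound; [case: supS|exists W].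
lra.
Qed.

(* If [V] were less than 1/3 on the orthogonal complement of the rows of [Q],
   then expanding that complement by the factor 3 would keep [V] bounded by 5/3
   and multiply its determinant by too much. *)
Lemma contractive_large_direction n k (V : 'M[R]_(n + n)) (Q : 'M[R]_(k, n + n)) :
  contractive V -> (forall W : 'M[R]_(n + n), contractive W -> \det W < 2 * \det V) ->
  0 < \det V -> (k < n)%N -> Q *m Q^T = 1%:M ->
  exists a, [/\ a *m Q^T = 0, l2 a = 1 & 3^-1 <= `|comb (a *m V)|].
Proof.
move=> cV maxV V0 kn QQ; apply: contrapT => /forallNP H.
have small b : b *m Q^T = 0 -> `|comb (b *m V)| <= l2 b / 3.
  move=> bQ; have [b0|b0] := eqVneq (l2 b) 0.
    by rewrite b0 mul0r (l2_eq0 b0) mul0mx -[0](scale0r 0) combZ scale0r normr0.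
  have lb : 0 < l2 b by rewrite lt_def b0 l2_ge0.
  rewrite leNgt; apply/negP => Hb; apply: (H ((l2 b)^-1 *: b)); split.
  - by rewrite -scalemxAl bQ scaler0.
  - by rewrite l2Z gtr0_norm ?invr_gt0 // mulVf.
  - by rewrite -scalemxAl combZ normrZ gtr0_norm ?invr_gt0 // ler_pdivlMl // ltW.
(* The inner matrix is the identity on the row space of [Q] and multiplies its orthogonal complement
   by 3; the factor 3/5 compensates the bound [1 + 2 / 3]. *)
pose W := (3 / 5) *: ((3%:M - 2 *: (Q^T *m Q)) *m V).
have cW : contractive W.
  move=> a; pose b := a - a *m Q^T *m Q.
  have bQ : b *m Q^T = 0 by rewrite mulmxBl -(mulmxA _ Q) QQ mulmx1 subrr.
  have -> : a *m W = (3 / 5) *: (a *m V + 2 *: (b *m V)).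
    rewrite /W -scalemxAr mulmxA; congr (_ *: _).
    rewrite [2 *: (b *m V)]scalemxAl -mulmxDl; congr (_ *m _).
    rewrite mulmxBr mul_mx_scalar -scalemxAr mulmxA /b scalerBr addrA.
    by rewrite -[X in X + 2 *: _]scale1r -scalerDl; congr (_ *: _ - _); rewrite addrC.
  rewrite combZ combD combZ normrZ (gtr0_norm (_ : 0 < 3 / 5 :> R)) //.
  have := ler_normD (comb (a *m V)) (2 *: comb (b *m V)).
  rewrite [in X in _ <= X -> _]normrZ (gtr0_norm (_ : 0 < 2 :> R)) //.
  have := cV a; have := small b bQ.
  have : l2 b <= l2 a by exact: l2_orthogonal_part.
  lra.
have := maxV _ cW; apply/negP; rewrite -leNgt.
have detW : \det W = (3 / 5) ^+ (n + n) * (3 ^+ (n + n) * 3^-1 ^+ k) * \det V.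
  rewrite detZ det_mulmx -!mulrA; congr (_ * _); rewrite !mulrA; congr (_ * _).
  have -> : 3%:M - 2 *: (Q^T *m Q) = 3 *: (1%:M + Q^T *m (- (2 / 3) *: Q)) :> 'M[R]_(n+n).
    rewrite scalerDr scalemx1 -scalemxAr scalerA -scaleNr; congr (_ + _ *: _).
    by field.
  rewrite detZ det_addmx_mulmxC -scalemxAl QQ; congr (_ * _).
  by rewrite scalemx1 -raddfD /= det_scalar; congr (_ ^+ _); field.
rewrite detW ler_pM2r // -(subnKC kn) addSn.
set m := (n - k.+1)%N.
(* With [n = k + m + 1] the gain is [(9/5)^(2n) / 3^k]. As [81/25 > 3], working in dimension [n + n]
   keeps it above 2 for every [k < n]. *)
have -> : (3 / 5) ^+ ((k + m).+1 + (k + m).+1) *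
    (3 ^+ ((k + m).+1 + (k + m).+1) * 3^-1 ^+ k) =
  81 / 25 * (81 / 25) ^+ m * (27 / 25) ^+ k :> R.
  rewrite mulrA -exprMn addnn -mul2n exprM.
  have -> : (3 / 5 * 3) ^+ 2 = 81 / 25 :> R by field.
  have -> : 27 / 25 = 81 / 25 * 3^-1 :> R by field.
  by rewrite exprS exprD (exprMn k (81 / 25)); ring.
apply: (@le_trans _ _ (2 * 1 * 1)); first by rewrite !mulr1.
apply: ler_pM => //; last by apply: exprn_ege1; lra.
by apply: ler_pM => //; [lra|apply: exprn_ege1; lra].
Qed.

Lemma contractive_orthonormal n : exists (V : 'M[R]_(n + n)) (Q : 'M[R]_(n, n + n)),
  [/\ contractive V, Q *m Q^T = 1%:M & forall i, 3^-1 <= `|comb (row i Q *m V)|].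
Proof.
have [V [cV V0 maxV]] := contractive_almost_max (n + n).
suff H k : (k <= n)%N -> exists Q : 'M[R]_(k, n + n),
    Q *m Q^T = 1%:M /\ forall i, 3^-1 <= `|comb (row i Q *m V)|.
  by have [Q [QQ HQ]] := H n (leqnn n); exists V, Q.
elim: k => [_|k IH kn].
  by exists 0; split=> [|[]//]; apply/matrixP => -[].
have [Q [QQ HQ]] := IH (ltnW kn).
have [a [aQ a1 aV]] := contractive_large_direction cV maxV V0 kn QQ.
exists (col_mx a Q); split; last first.
  move=> i; rewrite -[i](@fintype.splitK 1 k); case: (@fintype.split 1 k i) => j /=.
    by rewrite (@rowKu _ 1 k _ j a Q) row_id.
  by rewrite (@rowKd _ 1 k _ j a Q).
suff : col_mx a Q *m (col_mx a Q)^T = 1%:M :> 'M_(1 + k) by [].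
have Qa : Q *m a^T = 0 by rewrite -(trmxK (Q *m a^T)) trmx_mul trmxK aQ trmx0.
rewrite tr_col_mx mul_col_row QQ aQ Qa scalar_mx_block; congr block_mx.
by apply/matrixP => i j; rewrite !ord1 -l2_mulE a1 expr1n mxE.
Qed.

End DvoretzkyRogers.

Lemma dvoretzky_rogers (R : realType) (X : normedModType R) n : infinite_dim X ->
  exists u : 'I_n -> X, (forall c : 'I_n -> R,
    `|\sum_i c i *: u i| ^+ 2 <= \sum_i c i ^+ 2) /\ forall i, 3^-1 <= `|u i|.
Proof.
move=> hX; have [e eP] := separated_sequence hX.
have [V [Q [cV QQ HQ]]] := contractive_orthonormal eP n.
exists (fun i => comb e (row i Q *m V)); split=> // c.
pose a := \row_i c i.
have -> : \sum_i c i *: comb e (row i Q *m V) = comb e (a *m Q *m V).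
  rewrite /comb; under eq_bigr do rewrite scaler_sumr.
  rewrite exchange_big; apply: eq_bigr => j _.
  under eq_bigr do rewrite scalerA.
  rewrite -scaler_suml; congr (_ *: _); rewrite -mulmxA [RHS]mxE.
  by apply: eq_bigr => i _; rewrite -row_mul !mxE.
have -> : \sum_i c i ^+ 2 = l2 (a *m Q) ^+ 2.
  by rewrite l2_orthonormal // l2E; apply: eq_bigr => i _; rewrite mxE.
by rewrite ler_pXn2r ?nnegrE ?l2_ge0.
Qed.

(** * Averages over the discrete cube *)

Section Average.
Variable R : realType.

Definition avg (T : finType) (F : T -> R) : R := (\sum_t F t) / #|T|%:R.

Lemma eq_avg (T : finType) (F G : T -> R) : F =1 G -> avg F = avg G.
Proof. by move=> FG; congr (_ / _); apply: eq_bigr. Qed.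

Lemma avgD (T : finType) (F G : T -> R) : avg (fun t => F t + G t) = avg F + avg G.
Proof. by rewrite /avg big_split mulrDl. Qed.

Lemma avgZ (T : finType) c (F : T -> R) : avg (fun t => c * F t) = c * avg F.
Proof. by rewrite /avg -mulr_sumr mulrA. Qed.

Lemma avg_sum (T : finType) (I : Type) (r : seq I) (F : I -> T -> R) :
  avg (fun t => \sum_(i <- r) F i t) = \sum_(i <- r) avg (F i).
Proof. by rewrite /avg exchange_big mulr_suml. Qed.

Lemma avg_cst (T : finType) (c : R) : (0 < #|T|)%N -> avg (fun _ : T => c) = c.
Proof.
move=> T0; rewrite /avg sumr_const -[c *+ _]mulr_natr mulfK //.
by rewrite pnatr_eq0 -lt0n.
Qed.

Lemma le_avg (T : finType) (F G : T -> R) : (forall t, F t <= G t) -> avg F <= avg G.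
Proof. by move=> FG; rewrite ler_wpM2r ?invr_ge0 ?ler0n // ler_sum. Qed.

Lemma normr_avg_le (T : finType) (F : T -> R) : `|avg F| <= avg (fun t => `|F t|).
Proof.
by rewrite normrM normfV normr_nat ler_wpM2r ?invr_ge0 ?ler0n // ler_norm_sum.
Qed.

Lemma avg_exchange (S T : finType) (F : S -> T -> R) :
  avg (fun s => avg (F s)) = avg (fun t => avg (F^~ t)).
Proof.
rewrite /avg -mulr_suml exchange_big /= -mulrA [X in _ * X]mulrC mulrA.
by rewrite mulr_suml.
Qed.

Lemma avg_bij (S T : finType) (h : S -> T) (F : T -> R) :
  bijective h -> avg (F \o h) = avg F.
Proof.
move=> bh; rewrite /avg (bij_eq_card bh); congr (_ / _).
by rewrite [RHS](reindex h) //; exact: onW_bij.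
Qed.

Lemma avg_exists_le (T : finType) (F : T -> R) : (0 < #|T|)%N ->
  exists t, F t <= avg F.
Proof.
move=> T0; apply: contrapT => /forallNP H.
have : avg F < avg F; last by rewrite ltxx.
rewrite -[X in X < _](avg_cst _ T0) ltr_pM2r ?invr_gt0 ?ltr0n //.
have /card_gt0P[t0 _] := T0.
rewrite (bigD1 t0) //= [X in _ < X](bigD1 t0) //= ltr_leD //.
  by rewrite ltNge; apply/negP/H.
by apply: ler_sum => t _; rewrite leNgt; apply/negP => /ltW/H.
Qed.

End Average.

(** * Smoothing over coordinates and the Poincaré inequality on the cube *)

Section Signs.
Variables (R : realType) (I : finType).
Implicit Types (s t : {ffun I -> bool}) (F G : {ffun I -> bool} -> R).

Definition sxor t s : {ffun I -> bool} := [ffun i => t i (+) s i].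
Definition flip i s := sxor [ffun j => j == i] s.

Lemma sxorK t : involutive (sxor t).
Proof. by move=> s; apply/ffunP => i; rewrite !ffunE addbA addbb addFb. Qed.

Lemma flipC i j s : flip i (flip j s) = flip j (flip i s).
Proof. by apply/ffunP => k; rewrite !ffunE addbCA. Qed.

Lemma flipK i : involutive (flip i). Proof. exact: sxorK. Qed.

Lemma card_signs_gt0 : (0 < #|{: {ffun I -> bool}}|)%N.
Proof. by apply/card_gt0P; exists [ffun=> false]. Qed.

Lemma avg_sxor t F : avg (fun s => F (sxor t s)) = avg F.
Proof. exact: (avg_bij F (inv_bij (sxorK t))). Qed.

Lemma avg_flip i F : avg (fun s => F (flip i s)) = avg F.
Proof. exact: avg_sxor. Qed.

(** Conditional expectation given all coordinates except [i]. *)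
Definition smooth i F s := (F s + F (flip i s)) / 2.

Lemma smooth_energy i F : avg (fun s => F s ^+ 2) =
  avg (fun s => smooth i F s ^+ 2) + avg (fun s => ((F s - F (flip i s)) / 2) ^+ 2).
Proof.
have -> : avg (fun s => F s ^+ 2) =
    avg (fun s => 2^-1 * F s ^+ 2 + 2^-1 * F (flip i s) ^+ 2).
  by rewrite avgD !avgZ (avg_flip i (fun s => F s ^+ 2)) -mulrDl; field.
by rewrite -avgD; apply: eq_avg => s; rewrite /smooth; field.
Qed.

Definition smooths (l : seq I) F := foldr smooth F l.

Lemma smooths_flip l i F s : smooths l F (flip i s) = smooths l (F \o flip i) s.
Proof. by elim: l s => //= j l IH s; rewrite /smooth flipC !IH. Qed.

Lemma smoothsB l F G s :
  smooths l (fun s => (F s - G s) / 2) s = (smooths l F s - smooths l G s) / 2.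
Proof. by elim: l s => //= j l IH s; rewrite /smooth !IH; field. Qed.

Lemma smooths_contraction l F :
  avg (fun s => smooths l F s ^+ 2) <= avg (fun s => F s ^+ 2).
Proof.
elim: l => //= i l; apply: le_trans; rewrite (smooth_energy i (smooths l F)) lerDl.
rewrite -[leLHS](avg_cst 0 card_signs_gt0); apply: le_avg => s; exact: sqr_ge0.
Qed.

(** Each smoothing loses the energy of a half difference. Smoothing commutes with flips and is a
    contraction, so the half differences of [F] itself bound these losses. *)
Lemma smooths_energy l F : avg (fun s => F s ^+ 2) <=
  avg (fun s => smooths l F s ^+ 2) +
  \sum_(i <- l) avg (fun s => ((F s - F (flip i s)) / 2) ^+ 2).
Proof.
elim: l => [|i l IH]; first by rewrite big_nil addr0.
rewrite big_cons addrCA addrC; apply: le_trans IH _.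
rewrite addrAC lerD2r (smooth_energy i (smooths l F)) /= lerD2l.
apply: le_trans (smooths_contraction l (fun s => (F s - F (flip i s)) / 2)).
by apply: le_avg => s; rewrite smoothsB smooths_flip.
Qed.

Lemma flip_invariant_cst F s t : (forall i s, F (flip i s) = F s) -> F s = F t.
Proof.
move=> HF; suff H u : F u = F [ffun=> false] by rewrite H [RHS]H.
suff H (l : seq I) : F [ffun i => u i && (i \notin l)] = F u.
  rewrite -(H (enum I)); congr F; apply/ffunP => i.
  by rewrite !ffunE mem_enum andbF.
elim: l => [|i l <-]; first by congr F; apply/ffunP => i; rewrite ffunE andbT.
case: (boolP (u i && (i \notin l))) => uil.
  rewrite -(HF i); congr F; apply/ffunP => j; rewrite !ffunE in_cons.
  by case: eqVneq => [->|//]; rewrite uil andbF.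
congr F; apply/ffunP => j; rewrite !ffunE in_cons negb_or.
by case: eqVneq => [->|//]; rewrite (negbTE uil) andbF.
Qed.

Lemma avg_smooths l F : avg (smooths l F) = avg F.
Proof.
elim: l => //= i l <-.
have -> : avg (smooth i (smooths l F)) =
    avg (fun s => 2^-1 * smooths l F s + 2^-1 * smooths l F (flip i s)).
  by apply: eq_avg => s; rewrite /smooth; field.
by rewrite avgD !avgZ avg_flip; field.
Qed.

(** After smoothing in every coordinate the function is invariant under all flips, hence constant,
    and its average has not changed. *)
Lemma smooths_enum F s : smooths (enum I) F s = avg F.
Proof.
rewrite -(avg_smooths (enum I) F) -[LHS](avg_cst _ card_signs_gt0).
apply: eq_avg => t; apply: flip_invariant_cst => i u.
have : i \in enum I by rewrite mem_enum.
elim: (enum I) u => //= j l IH u; rewrite in_cons /smooth.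
have [->|_ /IH H] := eqVneq i j; first by rewrite flipK addrC.
by rewrite -[flip j (flip i u)]flipC !H.
Qed.

Lemma cube_poincare F : avg (fun s => (F s - avg F) ^+ 2) <=
  \sum_i avg (fun s => ((F s - F (flip i s)) / 2) ^+ 2).
Proof.
have := smooths_energy (enum I) F; rewrite big_enum /= -lerBlDl; apply: le_trans.
under [X in _ <= _ - X]eq_avg do rewrite smooths_enum.
rewrite avg_cst ?card_signs_gt0 //.
have -> : (fun s => (F s - avg F) ^+ 2) =
    (fun s => F s ^+ 2 + (-2 * avg F * F s + avg F ^+ 2)).
  by apply/funext => s; ring.
rewrite !avgD avgZ avg_cst ?card_signs_gt0 // lerD2l le_eqVlt; apply/orP; left.
by apply/eqP; ring.
Qed.

End Signs.

(** * Rademacher averages *)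

Section Rademacher.
Variables (R : realType) (X : normedModType R).

Definition rsum (I : finType) (w : I -> X) (s : {ffun I -> bool}) : X :=
  \sum_i (-1) ^+ s i *: w i.

Definition rad (I : finType) (w : I -> X) : R := avg (fun s => `|rsum w s|).

Lemma eq_rad (I : finType) (w w' : I -> X) : w =1 w' -> rad w = rad w'.
Proof. by move=> ww; congr rad; apply/funext. Qed.

Lemma rsum_flip (I : finType) (w : I -> X) i s :
  rsum w (flip i s) = rsum w s - 2 *: ((-1) ^+ s i *: w i).
Proof.
rewrite /rsum (bigD1 i) //= [in RHS](bigD1 i) //= addrAC !ffunE eqxx addTb signrN.
congr (_ + _).
  by rewrite scaleNr -[X in X - _]scale1r -scalerBl -scaleN1r; congr (_ *: _); lra.
by apply: eq_bigr => j ji; rewrite !ffunE (negbTE ji) addFb.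
Qed.

(** Jensen's inequality: [rad] is convex in the family of vectors. *)
Lemma rad_avg_le (I T : finType) (w : T -> I -> X) : (0 < #|T|)%N ->
  rad (fun i => (#|T|%:R)^-1 *: \sum_t w t i) <= avg (fun t => rad (w t)).
Proof.
move=> T0; rewrite /rad avg_exchange; apply: le_avg => s.
have -> : rsum (fun i => #|T|%:R^-1 *: \sum_t w t i) s =
    (#|T|%:R^-1) *: \sum_t rsum (w t) s.
  rewrite /rsum exchange_big scaler_sumr; apply: eq_bigr => i _.
  by rewrite -scaler_sumr !scalerA mulrC.
rewrite normrZ gtr0_norm ?invr_gt0 ?ltr0n // mulrC ler_wpM2r ?invr_ge0 ?ler0n //.
exact: ler_norm_sum.
Qed.

(** The sum for [w] is the convex combination, with weights [(1 + l) / 2] and [(1 - l) / 2], of the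
    sum for [w'] and its flip at [i]. *)
Lemma rad_contraction1 (I : finType) (w w' : I -> X) i (l : R) : `|l| <= 1 ->
  w i = l *: w' i -> (forall j, j != i -> w j = w' j) -> rad w <= rad w'.
Proof.
move=> l1 wi wj.
have [l_lo l_hi] : -1 <= l /\ l <= 1 by move: l1; rewrite ler_norml => /andP[].
have -> : rad w' = avg (fun s =>
    (1 + l) / 2 * `|rsum w' s| + (1 - l) / 2 * `|rsum w' (flip i s)|).
  by rewrite avgD !avgZ (avg_flip i (fun s => `|rsum w' s|)) -/(rad w'); field.
apply: le_avg => s.
have -> : rsum w s = ((1 + l) / 2) *: rsum w' s + ((1 - l) / 2) *: rsum w' (flip i s).
  have -> : rsum w s = rsum w' s + (l - 1) *: ((-1) ^+ s i *: w' i).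
    rewrite /rsum (bigD1 i) //= [in RHS](bigD1 i) //= wi addrAC; congr (_ + _).
      by rewrite -[X in _ = X + _]scale1r -scalerDl !scalerA; congr (_ *: _); ring.
    by apply: eq_bigr => j ji; rewrite wj.
  rewrite rsum_flip scalerBr addrA -scalerDl scalerA -scaleNr.
  have -> : (1 + l) / 2 + (1 - l) / 2 = 1 by field.
  by rewrite scale1r !scalerA; congr (_ + _ *: _); field.
apply: le_trans (ler_normD _ _) _.
by rewrite !normrZ (@ger0_norm _ (1 + l)) ?(@ger0_norm _ (1 - l)) ?(@ger0_norm _ 2^-1) //; lra.
Qed.

Lemma rad_contraction (I : finType) (w : I -> X) (a b : I -> R) :
  (forall i, `|a i| <= `|b i|) ->
  rad (fun i => a i *: w i) <= rad (fun i => b i *: w i).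
Proof.
move=> ab; pose c (l : seq I) i := if i \in l then a i else b i.
suff H l : rad (fun i => c l i *: w i) <= rad (fun i => b i *: w i).
  apply: le_trans (H (enum I)); rewrite le_eqVlt; apply/orP; left.
  by apply/eqP/eq_rad => i; rewrite /c mem_enum.
elim: l => [|i l IH]; first by rewrite le_eqVlt; apply/orP; left; apply/eqP/eq_rad.
apply: le_trans IH.
have aci : `|a i| <= `|c l i| by rewrite /c; case: ifP.
(* One coefficient is changed at a time. Where the denominator vanishes, so does [a i], and the
   value 0 of the quotient is right. *)
apply: (@rad_contraction1 _ _ _ i (a i / c l i)) => [||j ji].
- rewrite normrM normfV; have [->|c0] := eqVneq (c l i) 0.
    by rewrite normr0 invr0 mulr0.
  by rewrite ler_pdivrMr ?normr_gt0 // mul1r.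
- rewrite {1}/c in_cons eqxx scalerA; congr (_ *: _).
  have [c0|c0] := eqVneq (c l i) 0; last by rewrite divfK.
  by move: aci; rewrite c0 normr0 normr_le0 => /eqP ->; rewrite mulr0.
- by rewrite /c in_cons (negbTE ji).
Qed.

Lemma rad_ge_norm (I : finType) (w : I -> X) i : `|w i| <= rad w.
Proof.
have -> : `|w i| = rad (fun j => (j == i)%:R *: w j).
  rewrite /rad -[LHS](avg_cst _ (@card_signs_gt0 I)); apply: eq_avg => s.
  rewrite /rsum (bigD1 i) //= big1 => [|j /negbTE ->]; last by rewrite scale0r scaler0.
  by rewrite addr0 eqxx scale1r normrZ normrX normrN1 expr1n mul1r.
have -> : rad w = rad (fun j => 1 *: w j) by apply: eq_rad => j; rewrite scale1r.
by apply: rad_contraction => j; case: eqP; rewrite ?normr0 ?normr1.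
Qed.

Lemma radZ (I : finType) (w : I -> X) a : rad (fun i => a *: w i) = `|a| * rad w.
Proof.
rewrite /rad -avgZ; apply: eq_avg => s; rewrite -normrZ scaler_sumr.
by congr (`|_|); apply: eq_bigr => i _; rewrite !scalerA mulrC.
Qed.

Lemma rad_ge0 (I : finType) (w : I -> X) : 0 <= rad w.
Proof. by rewrite divr_ge0 ?ler0n // sumr_ge0. Qed.

(* Multiplying all signs [s j] with [p j = i] by a common independent sign
   [t i] does not change the distribution of [s]. *)
Lemma rad_fold (I J : finType) (p : J -> I) (b : J -> R) (w : I -> X) :
  rad (fun j => b j *: w (p j)) =
  avg (fun s : {ffun J -> bool} =>
    rad (fun i => (\sum_(j | p j == i) b j * (-1) ^+ s j) *: w i)).
Proof.
rewrite [RHS]avg_exchange -[LHS](avg_cst _ (@card_signs_gt0 I)).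
apply: eq_avg => t; rewrite /rad -(avg_sxor [ffun j => t (p j)]); apply: eq_avg => s.
congr (`|_|); rewrite /rsum (partition_big p predT) //=; apply: eq_bigr => i _.
rewrite scalerA mulr_sumr scaler_suml; apply: eq_bigr => j /eqP <-.
by rewrite !ffunE signr_addb !scalerA; congr (_ *: _); ring.
Qed.


Lemma avg_sign_step (J : finType) (l : seq J) j (F : R -> R) : j \notin l ->
  avg (fun s : {ffun J -> bool} => F (\sum_(k <- j :: l) (-1) ^+ s k)) =
  avg (fun s : {ffun J -> bool} => (F (\sum_(k <- l) (-1) ^+ s k + 1) +
                                    F (\sum_(k <- l) (-1) ^+ s k - 1)) / 2).
Proof.
move=> jl; set A := fun s : {ffun J -> bool} => \sum_(k <- l) (-1) ^+ s k : R.
have Afl s : A (flip j s) = A s.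
  apply: eq_big_seq => k kl; rewrite !ffunE; case: eqVneq => // kj.
  by rewrite -kj kl in jl.
transitivity (avg (fun s : {ffun J -> bool} =>
    2^-1 * F (A s + (-1) ^+ s j) + 2^-1 * F (A (flip j s) + (-1) ^+ flip j s j))).
  rewrite avgD !avgZ (avg_flip j (fun s => F (A s + (-1) ^+ s j))) -mulrDl.
  have -> : (2^-1 + 2^-1 : R) = 1 by field.
  by rewrite mul1r; apply: eq_avg => s; rewrite big_cons addrC.
apply: eq_avg => s; rewrite Afl !ffunE eqxx addTb signrN.
by case: (s j); rewrite /= ?expr1 ?expr0 ?opprK; field.
Qed.

Lemma avg_sign_moments (J : finType) (l : seq J) : uniq l ->
  avg (fun s : {ffun J -> bool} => (\sum_(k <- l) (-1) ^+ s k) ^+ 2) = (size l)%:R :> R /\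
  avg (fun s : {ffun J -> bool} => (\sum_(k <- l) (-1) ^+ s k) ^+ 4) =
    3 * (size l)%:R ^+ 2 - 2 * (size l)%:R :> R.
Proof.
elim: l => [_|j l IH /= /andP[jl /IH[IH2 IH4]]].
  split; under eq_avg do rewrite big_nil expr0n /=.
    by rewrite avg_cst ?card_signs_gt0.
  by rewrite avg_cst ?card_signs_gt0 //=; ring.
rewrite (avg_sign_step (fun x => x ^+ 2) jl) (avg_sign_step (fun x => x ^+ 4) jl).
split.
  transitivity (avg (fun s : {ffun J -> bool} => (\sum_(k <- l) (-1) ^+ s k) ^+ 2 + 1) : R).
    by apply: eq_avg => s; field.
  by rewrite avgD IH2 avg_cst ?card_signs_gt0 // natr1.
have -> : avg (fun s : {ffun J -> bool} => ((\sum_(k <- l) (-1) ^+ s k + 1) ^+ 4 +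
    (\sum_(k <- l) (-1) ^+ s k - 1) ^+ 4) / 2) =
  avg (fun s : {ffun J -> bool} => (\sum_(k <- l) (-1) ^+ s k) ^+ 4 +
    (6 * (\sum_(k <- l) (-1) ^+ s k) ^+ 2 + 1)) :> R.
  by apply: eq_avg => s; field.
by rewrite !avgD avgZ avg_cst ?card_signs_gt0 // IH4 IH2 -[(size l).+1%:R]natr1; ring.
Qed.

(** Second and fourth moments bound the first from below: with [r] the square root of [n], average
    the pointwise inequality [x^2 <= 2 r x + x^4 / (8 r^2)] at [x] equal to the modulus of the sign
    sum. *)
Lemma khintchine_ge (J : finType) (P : pred J) : 5 / 16 * Num.sqrt (#|P|%:R : R) <=
  avg (fun s : {ffun J -> bool} => `|\sum_(j | P j) (-1) ^+ s j|).
Proof.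
have := avg_sign_moments (enum_uniq P); rewrite -cardE.
under eq_avg do rewrite big_enum; under [X in _ /\ X = _]eq_avg do rewrite big_enum /=.
set A := fun s : {ffun J -> bool} => \sum_(j | P j) (-1) ^+ s j : R.
rewrite -/A; set n : R := #|P|%:R => -[m2 m4].
have [n0|n0] := eqVneq n 0.
  by rewrite n0 sqrtr0 mulr0 -[leLHS](avg_cst 0 (@card_signs_gt0 J)); apply: le_avg.
have np : 0 < n by rewrite lt_def n0 ler0n.
set r := Num.sqrt n; have r0 : 0 < r by rewrite sqrtr_gt0.
have rr : r ^+ 2 = n by rewrite sqr_sqrtr // ltW.
have : avg (fun s => A s ^+ 2) <=
    avg (fun s => 2 * r * `|A s| + (8 * n)^-1 * A s ^+ 4).
  apply: le_avg => s; have -> : A s ^+ 2 = `|A s| ^+ 2 by rewrite real_normK ?num_real.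
  have -> : A s ^+ 4 = `|A s| ^+ 4 by rewrite -[4%N]/(2 * 2)%N !exprM real_normK ?num_real.
  have : 0 <= `|A s| by []; move: `|A s| => x x0.
  rewrite -subr_ge0 -rr.
  have -> : 2 * r * x + (8 * r ^+ 2)^-1 * x ^+ 4 - x ^+ 2 =
     x / (8 * r ^+ 2) * ((x - 2 * r) ^+ 2 * (x + 4 * r) + 4 * r ^+ 2 * x).
    by field; rewrite gt_eqF.
  apply: mulr_ge0; first by rewrite divr_ge0 // mulr_ge0 // sqr_ge0.
  by rewrite addr_ge0 // mulr_ge0 ?sqr_ge0 ?addr_ge0 // mulr_ge0 // ?sqr_ge0 // ltW.
rewrite avgD !avgZ m2 m4.
have -> : (8 * n)^-1 * (3 * n ^+ 2 - 2 * n) = 3 / 8 * n - 4^-1 by field.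
set E := avg _ => H; have {H} : 5 / 8 * r ^+ 2 <= 2 * r * E by rewrite rr; lra.
by move=> H; rewrite -(ler_pM2r r0); lra.
Qed.

(** Folding turns the copies of [w i] into one random coefficient. Contraction replaces it by its
    modulus, Jensen averages it, and Khintchine bounds that average from below. *)
Lemma rad_copies (I K : finType) (w : I -> X) :
  5 / 16 * Num.sqrt (#|K|%:R) * rad w <= rad (fun p : K * I => w p.2).
Proof.
have -> : rad (fun p : K * I => w p.2) = rad (fun p : K * I => 1 *: w p.2).
  by apply: eq_rad => p; rewrite scale1r.
rewrite (rad_fold snd (fun=> 1) w).
pose S (s : {ffun K * I -> bool}) i : R := \sum_(j | j.2 == i) 1 * (-1) ^+ s j.
apply: (@le_trans _ _ (avg (fun s => rad (fun i => `|S s i| *: w i)))); last first.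
  by apply: le_avg => s; apply: rad_contraction => i; rewrite normr_id.
apply: le_trans (rad_avg_le _ (@card_signs_gt0 _)).
have c0 : 0 <= 5 / 16 * Num.sqrt (#|K|%:R : R) by rewrite mulr_ge0 // sqrtr_ge0.
rewrite -[X in X * rad w](ger0_norm c0) -radZ.
under [X in _ <= rad X]eq_fun do rewrite -scaler_suml scalerA mulrC.
apply: rad_contraction => i; rewrite ger0_norm //; apply: le_trans (ler_norm _).
apply: le_trans (_ : _ <= 5 / 16 * Num.sqrt (#|[pred j : K * I | j.2 == i]|%:R)) _.
  rewrite le_eqVlt; apply/orP; left; apply/eqP; congr (_ * Num.sqrt _%:R).
  have inj : injective (fun k : K => (k, i)) by move=> k k' [].
  rewrite -(card_codom inj); apply: eq_card => -[k i']; rewrite !inE /=.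
  by apply/idP/idP => [/codomP[k' [_ ->]]|/eqP ->]; [rewrite eqxx|apply/codomP; exists k].
apply: le_trans (khintchine_ge _) _; apply: le_avg => s.
rewrite le_eqVlt; apply/orP; left; apply/eqP; congr (`|_|).
by apply: eq_bigr => j _; rewrite mul1r.
Qed.

(** After folding, each coefficient is a single sign, so contraction applies in both directions. *)
Lemma rad_embed (I J : finType) (j0 : J) (w : I -> X) :
  rad (fun p : J * I => (p.1 == j0)%:R *: w p.2) = rad w.
Proof.
rewrite (rad_fold snd (fun p => (p.1 == j0)%:R) w).
rewrite -[RHS](avg_cst _ (@card_signs_gt0 (J * I)%type)).
apply: eq_avg => s.
have -> : rad w = rad (fun i => 1 *: w i) by apply: eq_rad => i; rewrite scale1r.
have E i : \sum_(j : J * I | j.2 == i) (j.1 == j0)%:R * (-1) ^+ s j = (-1) ^+ s (j0, i) :> R.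
  rewrite (bigD1 (j0, i)) //= eqxx mul1r big1 ?addr0 // => -[j i'] /= /andP[/eqP -> ji].
  by have [jj|_] := eqVneq j j0; rewrite ?mul0r //; rewrite jj eqxx in ji.
by apply/eqP; rewrite eq_le; apply/andP; split; apply: rad_contraction => i;
   rewrite E normrX normrN1 expr1n normr1.
Qed.

End Rademacher.

(** * Concentration of Rademacher sums *)

Lemma sum_cauchy_schwarz (R : realFieldType) (I : finType) (P : pred I) (a b : I -> R) :
  (\sum_(i | P i) a i * b i) ^+ 2 <=
  (\sum_(i | P i) a i ^+ 2) * (\sum_(i | P i) b i ^+ 2).
Proof.
set A := \sum_(i | P i) a i ^+ 2; set B := \sum_(i | P i) b i ^+ 2.
set C := \sum_(i | P i) a i * b i.
have B0 : 0 <= B by apply: sumr_ge0 => i _; rewrite sqr_ge0.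
have A0 : 0 <= A by apply: sumr_ge0 => i _; rewrite sqr_ge0.
have key (x y : R) : 0 <= x ^+ 2 * A + y ^+ 2 * B - 2 * x * y * C.
  rewrite /A /B /C !mulr_sumr -sumrN -!big_split /=; apply: sumr_ge0 => i _.
  apply: le_trans (sqr_ge0 (x * a i - y * b i)) _.
  by rewrite le_eqVlt; apply/orP; left; apply/eqP; ring.
have [BE|BN] := eqVneq B 0.
  rewrite BE mulr0; have [->|CN] := eqVneq C 0; first by rewrite expr0n.
  (* With [B = 0] and [C] nonzero, this choice would give the quadratic form the value -1. *)
  have := key 1 ((A + 1) / (2 * C)); rewrite BE mulr0 addr0 expr1n mul1r mulr1.
  have -> : A - 2 * ((A + 1) / (2 * C)) * C = -1 by field.
  by rewrite ler0N1.
have Bp : 0 < B by rewrite lt_def BN.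
have := key B C; have -> : B ^+ 2 * A + C ^+ 2 * B - 2 * B * C * C = B * (A * B - C ^+ 2).
  by ring.
by rewrite pmulr_rge0 // subr_ge0.
Qed.

Section Concentration.
Variables (R : realType) (X : normedModType R).

(** The operator from Euclidean space sending the basis to [w] has squared norm at most [tau2], the
    weak variance of the Rademacher sum. *)
Definition l2_bounded (I : finType) (w : I -> X) (tau2 : R) := forall c : I -> R,
  `|\sum_i c i *: w i| ^+ 2 <= tau2 * \sum_i c i ^+ 2.

Lemma l2_bounded_tensor (I J : finType) (w : I -> X) (a : J -> R) :
  l2_bounded w 1 ->
  l2_bounded (fun p : J * I => a p.1 *: w p.2) (\sum_j a j ^+ 2).
Proof.
move=> w1 c.
have -> : \sum_(p : J * I) c p *: (a p.1 *: w p.2) =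
    \sum_i (\sum_j a j * c (j, i)) *: w i.
  transitivity (\sum_j \sum_i c (j, i) *: (a j *: w i)).
    by rewrite pair_bigA; apply: eq_bigr => -[].
  rewrite exchange_big; apply: eq_bigr => i _; rewrite scaler_suml; apply: eq_bigr => j _.
  by rewrite scalerA mulrC.
apply: le_trans (w1 _) _; rewrite mul1r.
have -> : \sum_p c p ^+ 2 = \sum_j \sum_i c (j, i) ^+ 2.
  by rewrite pair_bigA; apply: eq_bigr => -[].
rewrite exchange_big mulr_sumr.
by apply: ler_sum => i _; exact: sum_cauchy_schwarz.
Qed.

(* Moving from [rsum w s] to [rsum w s - t *: h], towards the points
   [rsum w (flip i s)] with weights [t * d i], lowers the norm by at least [t * D]
   by convexity, and by at most [t * `|h|]. *)
Lemma rsum_descent (I : finType) (w : I -> X) tau2 s : 0 <= tau2 ->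
  l2_bounded w tau2 ->
  \sum_i Num.max 0 (`|rsum w s| - `|rsum w (flip i s)|) ^+ 2 <= 4 * tau2.
Proof.
move=> tau0 wb; pose d i := Num.max 0 (`|rsum w s| - `|rsum w (flip i s)|).
change (\sum_i d i ^+ 2 <= 4 * tau2).
have d0 i : 0 <= d i by rewrite /d le_max lexx.
set D := \sum_i _; set S := rsum w s.
have D0 : 0 <= D by apply: sumr_ge0 => i _; rewrite sqr_ge0.
pose t := (1 + \sum_i d i)^-1.
have sd0 : 0 <= \sum_i d i by apply: sumr_ge0.
have t0 : 0 < t by rewrite invr_gt0 ltr_pwDl.
have t1 : 0 <= 1 - t * \sum_i d i.
  rewrite subr_ge0 /t mulrC ler_pdivrMr ?ltr_pwDl // mul1r; lra.
pose h := \sum_i (2 * d i * (-1) ^+ s i) *: w i.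
have step : D <= `|h|.
  rewrite -(ler_pM2l t0).
  have : `|S| <= `|S - t *: h| + t * `|h|.
    rewrite -{1}(subrK (t *: h) S); apply: le_trans (ler_normD _ _) _.
    by rewrite lerD2l normrZ gtr0_norm.
  suff : `|S - t *: h| <= `|S| - t * D by lra.
  have -> : S - t *: h = (1 - t * \sum_i d i) *: S + \sum_i (t * d i) *: rsum w (flip i s).
    under [X in _ = _ + X]eq_bigr do rewrite rsum_flip scalerBr.
    rewrite sumrB -scaler_suml -mulr_sumr scalerBl scale1r addrA subrK; congr (_ - _).
    rewrite scaler_sumr; apply: eq_bigr => i _; rewrite !scalerA; congr (_ *: _); ring.
  apply: le_trans (ler_normD _ _) _; rewrite normrZ (ger0_norm t1).
  have : `|\sum_i (t * d i) *: rsum w (flip i s)| <= \sum_i t * d i * (`|S| - d i).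
    apply: le_trans (ler_norm_sum _ _ _) _; apply: ler_sum => i _.
    rewrite normrZ ger0_norm; last by rewrite mulr_ge0 // ltW.
    rewrite /d; case: (leP (`|S| - `|rsum w (flip i s)|) 0) => _.
      by rewrite mulr0 !mul0r.
    by rewrite subKr.
  have -> : \sum_i t * d i * (`|S| - d i) = t * (\sum_i d i) * `|S| - t * D.
    rewrite /D !mulr_sumr mulr_suml -sumrB; apply: eq_bigr => i _; ring.
  lra.
(* The squared coefficients of [h] add up to [4 * D], so with [step] this gives
   [D ^+ 2 <= 4 * tau2 * D]. *)
have h2 : `|h| ^+ 2 <= 4 * tau2 * D.
  apply: le_trans (wb _) _; have -> : \sum_i (2 * d i * (-1) ^+ s i) ^+ 2 = 4 * D.
    rewrite mulr_sumr; apply: eq_bigr => i _.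
    by rewrite !exprMn sqrr_sign mulr1; congr (_ * _); ring.
  lra.
have : D ^+ 2 <= 4 * tau2 * D.
  by apply: le_trans h2; rewrite ler_pXn2r ?nnegrE.
have [->|DN] := eqVneq D 0; first by rewrite mulr_ge0.
by rewrite expr2 ler_pM2r // lt_def DN.
Qed.

(** In the Poincaré inequality only decreases of the norm need be counted: a flip pairs each
    increase with a decrease. [rsum_descent] bounds the decreases. *)
Lemma rad_variance (I : finType) (w : I -> X) tau2 : 0 <= tau2 ->
  l2_bounded w tau2 ->
  avg (fun s => (`|rsum w s| - rad w) ^+ 2) <= 2 * tau2.
Proof.
move=> tau0 wb; apply: le_trans (cube_poincare (fun s => `|rsum w s|)) _.
pose d i s := Num.max 0 (`|rsum w s| - `|rsum w (flip i s)|).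
have E i : avg (fun s => ((`|rsum w s| - `|rsum w (flip i s)|) / 2) ^+ 2) =
    2^-1 * avg (fun s => d i s ^+ 2).
  transitivity (avg (fun s => 4^-1 * d i s ^+ 2 + 4^-1 * d i (flip i s) ^+ 2)).
    apply: eq_avg => s; rewrite /d flipK.
    move: `|rsum w s| `|rsum w (flip i s)| => x y.
    case: (leP (x - y) 0) => xy; case: (leP (y - x) 0) => yx.
    + have -> : x = y by lra.
      by rewrite subrr mul0r expr0n /= !mulr0 addr0.
    + by field.
    + by field.
    + lra.
  by rewrite avgD !avgZ (avg_flip i (fun s => d i s ^+ 2)); field.
under eq_bigr do rewrite E.
rewrite -mulr_sumr -avg_sum.
have : avg (fun s => \sum_i d i s ^+ 2) <= 4 * tau2.
  rewrite -[leRHS](avg_cst _ (@card_signs_gt0 I)); apply: le_avg => s.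
  exact: rsum_descent.
lra.
Qed.
End Concentration.

(** * Almost isometric nets *)

Lemma avg_prod (R : realType) (I T : finType) (G : T -> R) :
  avg (fun f : {ffun I -> T} => \prod_i G (f i)) = avg G ^+ #|I|.
Proof.
rewrite /avg card_ffun natrX exprMn exprVn; congr (_ / _).
by rewrite -(bigA_distr_bigA (fun=> G)) prodr_const.
Qed.

(** Bernoulli's inequality [1 + n/m <= (1 + 1/m)^n], denominators cleared. *)
Lemma expn_succ_ge (m n : nat) : (m ^ n * (m + n) <= m * m.+1 ^ n)%N.
Proof.
elim: n => [|n IH]; first by rewrite !expn0 addn0 mul1n muln1.
rewrite !expnS [X in (_ <= X)%N]mulnCA.
apply: (@leq_trans (m.+1 * (m ^ n * (m + n)))); last by rewrite leq_mul2l IH.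
have H : (m * (m + n.+1) <= m.+1 * (m + n))%N by nia.
by rewrite mulnCA -mulnA mulnCA leq_mul2l H orbT.
Qed.

Lemma avg_all_coordinates_le (R : realType) (I T : finType) (t0 : T) :
  (1 < #|T|)%N -> #|I| = #|T|.-1 ->
  avg (fun f : {ffun I -> T} => \prod_i (f i != t0)%:R) <= 2^-1 :> R.
Proof.
move=> T1 IT; rewrite (avg_prod _ (fun t => (t != t0)%:R)) IT.
set m := #|T|.-1; have mT : #|T| = m.+1 by rewrite prednK // ltnW.
have m0 : (0 < m)%N by rewrite -ltnS -mT.
have -> : avg (fun t => (t != t0)%:R) = m%:R / m.+1%:R :> R.
  rewrite /avg mT; congr (_ / _); rewrite -natr_sum; congr (_%:R).
  rewrite (bigD1 t0) //= eqxx add0n (eq_bigr (fun=> 1%N)) => [|t ->//].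
  by rewrite sum1_card cardC1.
have := expn_succ_ge m m; rewrite addnn -mul2n mulnA mulnC leq_pmul2l //.
rewrite -(ler_nat R) natrM !natrX exprMn exprVn => H.
by rewrite ler_pdivrMr ?exprn_gt0 ?ltr0n //; lra.
Qed.

Lemma int_shift9 (z : int) : `|z| <= 9 -> exists k : 'I_19, (k : nat)%:Z - 9 = z.
Proof.
rewrite ler_norml => /andP[lo hi]; exists (inord (absz (z + 9))).
by rewrite inordK; lia.
Qed.

(** * Large Rademacher averages and nets with integer coefficients *)

Section LargeAverages.
Variables (R : realType) (X : normedModType R).

(** There are so many indices that with probability at least 1/2 some [i] has all its copies signed
    [+]. Its folded coefficient is then [#|J|], and [rad_ge_norm] applies. *)
Lemma rad_copies_max (I J : finType) (w : I -> X) (b : R) :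
  #|I| = #|{: {ffun J -> bool}}|.-1 ->
  (0 < #|J|)%N -> 0 <= b -> (forall i, b <= `|w i|) ->
  #|J|%:R * b / 2 <= rad (fun p : J * I => w p.2).
Proof.
move=> cI J0 b0 bw.
have -> : rad (fun p : J * I => w p.2) = rad (fun p : J * I => 1 *: w p.2).
  by apply: eq_rad => p; rewrite scale1r.
rewrite (rad_fold snd (fun=> 1) w).
(* Indicator of the event that no index has all its signs equal to [+]. *)
pose bad (s : {ffun J * I -> bool}) : R :=
  \prod_i ([ffun j => s (j, i)] != [ffun=> false] :> {ffun J -> bool})%:R.
have bad_le : avg bad <= 2^-1.
  pose h (f : {ffun I -> {ffun J -> bool}}) : {ffun J * I -> bool} := [ffun p => f p.2 p.1].
  have bh : bijective h.
    exists (fun s : {ffun J * I -> bool} =>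
      [ffun i => [ffun j => s (j, i)]] : {ffun I -> {ffun J -> bool}}) => [f|s].
      by apply/ffunP => i; apply/ffunP => j; rewrite !ffunE.
    by apply/ffunP => -[j i]; rewrite !ffunE.
  rewrite -(avg_bij bad bh).
  have J1 : (1 < #|{: {ffun J -> bool}}|)%N.
    by rewrite card_ffun card_bool -[X in (X < _)%N](expn0 2) ltn_exp2l.
  apply: le_trans (avg_all_coordinates_le R [ffun=> false] J1 cI).
  apply: le_avg => f; rewrite le_eqVlt; apply/orP; left; apply/eqP.
  apply: eq_bigr => i _; congr (~~ (_ == _))%:R.
  by apply/ffunP => j; rewrite !ffunE.
apply: (@le_trans _ _ (avg (fun s => #|J|%:R * b * (1 - bad s)))).
  rewrite avgZ ler_wpM2l ?mulr_ge0 ?ler0n //.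
  have -> : avg (fun s => 1 - bad s) = avg (fun s => 1 + -1 * bad s).
    by apply: eq_avg => s; rewrite mulN1r.
  rewrite avgD avgZ avg_cst ?card_signs_gt0 //; lra.
apply: le_avg => s.
have [/existsP[i /eqP si]|/existsPn H] :=
    boolP [exists i, [ffun j => s (j, i)] == [ffun=> false] :> {ffun J -> bool}].
  rewrite /bad (bigD1 i) //= si eqxx mul0r subr0 mulr1.
  apply: le_trans (rad_ge_norm _ i); rewrite normrZ.
  apply: ler_pM; [exact: ler0n|by []| |exact: bw].
  have -> : \sum_(j : J * I | j.2 == i) 1 * (-1) ^+ s j = #|J|%:R :> R.
    transitivity (\sum_(j : J) \sum_(k : I | k == i) 1 * (-1) ^+ s (j, k) : R).
      by rewrite pair_big_dep /=; apply: eq_bigr => -[].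
    under eq_bigr do rewrite big_pred1_eq mul1r.
    rewrite -sum1_card natr_sum; apply: eq_bigr => j _.
    by have := congr1 (fun f : {ffun J -> bool} => f j) si; rewrite !ffunE => ->.
  by rewrite ger0_norm.
rewrite /bad big1 ?subrr ?mulr0 ?rad_ge0 // => i _.
by rewrite (negbTE (H i)).
Qed.

(** Repeating the Dvoretzky-Rogers vectors [r * r] times with factor [1/r] keeps the bound 1, while
    the average is at least [r * r * (1/3) / 2 / r = r / 6]. *)
Lemma l2_bounded_large_rad (T : R) : infinite_dim X ->
  exists (I : finType) (w : I -> X), l2_bounded w 1 /\ T <= rad w.
Proof.
move=> hX; pose r := (Num.truncn (6 * `|T|)).+1.
have rT : 6 * T <= r%:R.
  apply: le_trans (_ : 6 * `|T| <= _); first by rewrite ler_pM2l // ler_norm.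
  by apply/ltW; rewrite /r truncnS_gt // mulr_ge0.
have r0 : 0 < r%:R :> R by rewrite ltr0n.
pose J : finType := 'I_(r * r); pose n := #|{: {ffun J -> bool}}|.-1.
have [u [ub u3]] := dvoretzky_rogers n hX.
have ub1 : l2_bounded u 1 by move=> c; rewrite mul1r ub.
exists (J * 'I_n)%type, (fun p => r%:R^-1 *: u p.2); split.
  have := l2_bounded_tensor (fun _ : J => r%:R^-1) ub1.
  suff -> : \sum_(j : J) r%:R^-1 ^+ 2 = 1 :> R by [].
  rewrite sumr_const card_ord -[_ *+ (r * r)]mulr_natr natrM; field.
  by rewrite gt_eqF.
rewrite (radZ (fun p : J * 'I_n => u p.2)) gtr0_norm ?invr_gt0 //.
have := @rad_copies_max 'I_n J u 3^-1; rewrite card_ord /J card_ord muln_gt0 /=.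
move=> /(_ erefl erefl (ltW _) u3) H.
rewrite mulrC ler_pdivlMr //; apply: le_trans (H _) => //.
by rewrite natrM -mulrA -(@ler_pM2l _ 6) // ; nra.
Qed.

(** A single choice of signs makes all the finitely many integer combinations concentrate at once.
    Dividing by the average [L0] for coefficients 1, contraction compares the other averages with
    [L0]. *)
Lemma l2_almost_isometric_net (J : finType) : infinite_dim X -> (0 < #|J|)%N ->
  exists g : J -> X, (forall j, `|g j| ^+ 2 <= 41 / #|J|%:R) /\
    forall a : J -> int, (forall j, `|a j| <= 9) ->
      `|\sum_j (a j)%:~R *: g j| <= 10 /\
      ((forall j, a j != 0) -> 2^-1 <= `|\sum_j (a j)%:~R *: g j|).
Proof.
move=> hX J0; pose Q := {ffun J -> 'I_19}.
pose co (q : Q) j : R := ((q j : nat)%:Z - 9)%:~R.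
(* Sum of the variance bounds over all coefficient vectors; [d] exceeds its square root and is the
   common deviation. *)
pose D : R := \sum_q 2 * \sum_j co q j ^+ 2.
have D0 : 0 <= D.
  by apply: sumr_ge0 => q _; rewrite mulr_ge0 // sumr_ge0 // => j _; rewrite sqr_ge0.
pose d := D + 1; have dD : D <= d ^+ 2 by rewrite /d; nra.
have d1 : 1 <= d by rewrite /d; lra.
(* Since [7 * 5 / 16 > 2], this makes [L0] at least [2 * d], so deviations cost at most half of
   [L0]. *)
have [I [w [w1 wT]]] := l2_bounded_large_rad (7 * d) hX.
pose W a (p : J * I) := a p.1 *: w p.2 : X.
pose L0 := rad (fun p : J * I => w p.2).
have L0E : L0 = rad (W (fun=> 1)) by apply: eq_rad => p; rewrite /W scale1r.
set N : R := #|J|%:R.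
have L0w : 5 / 16 * Num.sqrt N * rad w <= L0 by exact: rad_copies.
have N1 : 1 <= N by rewrite ler1n.
have sN1 : 1 <= Num.sqrt N by rewrite -sqrtr1 ler_sqrt ?(lt_le_trans ltr01).
have L0d : 2 * d <= L0.
  apply: le_trans L0w; apply: (@le_trans _ _ (5 / 16 * 1 * (7 * d))); first lra.
  by apply: ler_pM; lra.
have L0p : 0 < L0 by lra.
have [s sP] : exists s : {ffun J * I -> bool},
    \sum_q (`|rsum (W (co q)) s| - rad (W (co q))) ^+ 2 <= D.
  have [s sP] := @avg_exists_le R _ (fun s : {ffun J * I -> bool} =>
    \sum_q (`|rsum (W (co q)) s| - rad (W (co q))) ^+ 2) (card_signs_gt0 _).
  exists s; apply: le_trans sP _; rewrite avg_sum; apply: ler_sum => q _.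
  apply: rad_variance; first by apply: sumr_ge0 => j _; rewrite sqr_ge0.
  exact: l2_bounded_tensor.
have close q : `| `|rsum (W (co q)) s| - rad (W (co q))| <= d.
  rewrite -(ler_pXn2r (ltn0Sn 1)) ?nnegrE ?normr_ge0 //; last lra.
  rewrite real_normK ?num_real //; apply: le_trans dD; apply: le_trans sP.
  by rewrite (bigD1 q) //= lerDl sumr_ge0 // => q' _; rewrite sqr_ge0.
pose G j : X := \sum_i (-1) ^+ s (j, i) *: w i.
have rsumE a : rsum (W a) s = \sum_j a j *: G j.
  rewrite /rsum; transitivity (\sum_j \sum_i (-1) ^+ s (j, i) *: (a j *: w i)).
    by rewrite pair_bigA; apply: eq_bigr => -[].
  apply: eq_bigr => j _; rewrite scaler_sumr; apply: eq_bigr => i _.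
  by rewrite !scalerA mulrC.
have coP (a : J -> int) : (forall j, `|a j| <= 9) -> exists q, co q = fun j => (a j)%:~R.
  move=> a9; have /choice[k kP] j := int_shift9 (a9 j).
  by exists [ffun j => k j]; apply/funext => j; rewrite /co ffunE kP.
pose g j := L0^-1 *: G j; exists g.
have gE (a : J -> R) : `|\sum_j a j *: g j| = `|rsum (W a) s| / L0.
  rewrite rsumE -[X in _ = _ / X]gtr0_norm // -normfV mulrC -normrZ scaler_sumr; congr (`|_|).
  by apply: eq_bigr => j _; rewrite !scalerA mulrC.
split=> [j0|a a9].
  (* The vector [g j0] is itself such a combination, with average [rad w]. As [L0] is at least
     [5/16] times the root of [N] times [rad w], its norm is small; [(32/5)^2 < 41]. *)
  have [q qE] : exists q, co q = fun j => ((j == j0)%:Z)%:~R.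
    by apply: coP => j; case: eqP.
  have := close q; rewrite qE.
  have -> : rad (W (fun j => ((j == j0)%:Z)%:~R)) = rad w.
    rewrite -(rad_embed j0 w); apply: eq_rad => p; rewrite /W.
    by case: eqP.
  have -> : `|rsum (W (fun j => ((j == j0)%:Z)%:~R)) s| = L0 * `|g j0|.
    have := gE (fun j => ((j == j0)%:Z)%:~R).
    rewrite (bigD1 j0) //= eqxx scale1r big1 => [|j /negbTE ->]; last by rewrite scale0r.
    by rewrite addr0 => ->; rewrite mulrCA divff ?mulr1 // gt_eqF.
  rewrite ler_norml => /andP[_ H].
  have Hg : L0 * `|g j0| <= 2 * rad w by lra.
  have {}Hg : Num.sqrt N * `|g j0| <= 32 / 5.
    rewrite -(ler_pM2l L0p) mulrCA.
    apply: (@le_trans _ _ (Num.sqrt N * (2 * rad w))); first by rewrite ler_pM2l // ; lra.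
    lra.
  rewrite ler_pdivlMr; last lra.
  have -> : N = Num.sqrt N ^+ 2 by rewrite sqr_sqrtr //; lra.
  rewrite -exprMn mulrC; apply: (@le_trans _ _ ((32 / 5) ^+ 2)); last lra.
  by rewrite ler_pXn2r // ?nnegrE ?mulr_ge0 ?sqrtr_ge0.
have [q qE] := coP a a9; have := close q; rewrite qE gE ler_norml => /andP[H1 H2].
split=> [|a0].
  have : rad (W (fun j => (a j)%:~R)) <= 9 * L0.
    rewrite -[X in X * L0]ger0_norm // -radZ; apply: (@rad_contraction _ _ _ _ _ (fun=> 9)) => p.
    by rewrite -intr_norm (ger0_norm (_ : 0 <= 9 :> R)) // (ler_int R _ 9).
  by move=> H; rewrite ler_pdivrMr //; lra.
have : L0 <= rad (W (fun j => (a j)%:~R)).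
  rewrite L0E; apply: rad_contraction => p.
  by rewrite normr1 -intr_norm (ler_int R 1) -gtz0_ge1 normr_gt0 a0.
by move=> H; rewrite ler_pdivlMr //; lra.
Qed.
End LargeAverages.

(** * Taylor formula along segments *)

Section Diagonal.
Variables (R : realType) (X : normedModType R).

Definition diagonal n (u : X) (N : mform X n) : R := N (fun=> u).

Lemma diagonal_le n (u : X) (N : mform X n) : `|diagonal u N| <= `|N| * `|u| ^+ n.
Proof.
rewrite /diagonal.
have -> : (fun=> u) = (fun _ : 'I_n => `|u| *: (`|u|^-1 *: u)).
  apply/funext => _; have [->|u0] := eqVneq u 0; first by rewrite !scaler0.
  by rewrite scalerA divff ?scale1r // normr_eq0.
rewrite mform_scale normrM ger0_norm ?exprn_ge0 // mulrC ler_wpM2r ?exprn_ge0 //.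
apply: le_mnorm_box => i; rewrite normrZ.
have [->|u0] := eqVneq u 0; first by rewrite normr0 mulr0.
by rewrite normfV normr_id mulVf ?normr_eq0.
Qed.

Lemma diagonal_is_linear n (u : X) : linear (@diagonal n u : _ -> R^o).
Proof. by []. Qed.
HB.instance Definition _ n u := GRing.isLinear.Build R (mform X n) R^o _
  (@diagonal n u) (@diagonal_is_linear n u).

Lemma diagonal_continuous n (u : X) : continuous (@diagonal n u : _ -> R^o).
Proof.
apply: bounded_linear_continuous; apply/linear_boundedP.
exists (`|u| ^+ n); split; first exact: num_real.
move=> r /ltW ur N; apply: le_trans (diagonal_le _ _) _.
by rewrite mulrC ler_wpM2r.
Qed.

Lemma is_derive_line (W : normedModType R) (f : X -> W) (x u : X) (t : R) :
  differentiable f (x + t *: u) ->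
  is_derive t 1 (fun t => f (x + t *: u)) ('d f (x + t *: u) u).
Proof.
move=> df.
have dl : is_diff t (fun t : R => x + t *: u) (fun h : R => h *: u).
  have H := is_diffD (is_diff_cst x t) (is_diff_scalel t u).
  by apply: (is_diff_eq H); rewrite funeqE => h; exact: add0r.
have dc := is_diff_comp dl (differentiableP df).
apply: DeriveDef; first exact/diff_derivable/ex_diff.
rewrite deriveE; last exact: ex_diff.
by rewrite (@diff_val _ _ _ _ _ _ _ dc) /= scale1r.
Qed.

(** The mean value theorem is applied twice, first to [psi] minus its linear part, then to [phi]
    minus its quadratic part. *)
Lemma taylor2_bound (phi psi chi : R -> R) (B : R) :
  (forall t : R, 0 <= t <= 1 -> is_derive t 1 phi (psi t)) ->
  (forall t : R, 0 <= t <= 1 -> is_derive t 1 psi (chi t)) ->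
  (forall t : R, 0 <= t <= 1 -> `|chi t - chi 0| <= B) ->
  `|phi 1 - phi 0 - psi 0 - chi 0 / 2| <= B.
Proof.
move=> dphi dpsi Bchi.
have derive_cts (h dh : R -> R) (s : R) : s <= 1 ->
    (forall t : R, 0 <= t <= 1 -> is_derive t 1 h (dh t)) -> {within `[0, s], continuous h}.
  move=> s1 hd; apply: derivable_within_continuous => t; rewrite in_itv /= => /andP[t0 ts].
  by have := hd t; rewrite t0 (le_trans ts s1) => /(_ isT) [].
have B0 : 0 <= B by apply: le_trans (normr_ge0 _) (Bchi 0 _); rewrite lexx ler01.
have psi_bound (t : R) : 0 <= t <= 1 -> `|psi t - psi 0 - t * chi 0| <= B.
  move=> /andP[t0 t1].
  pose h (s : R) := psi s - s * chi 0.
  have hd (s : R) : 0 <= s <= 1 -> is_derive s 1 h (chi s - chi 0).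
    move=> s01; have := dpsi s s01 => dps.
    by apply: is_derive_eq; rewrite /GRing.scale /=; ring.
  have [|c] := @MVT_segment R h (fun s => chi s - chi 0) 0 t t0 _ (derive_cts _ _ _ t1 hd).
    move=> s; rewrite in_itv /= => /andP[/ltW s0 /ltW st]; apply: hd.
    by rewrite s0 (le_trans st).
  rewrite in_itv /= /h => /andP[c0 ct] H.
  have -> : psi t - psi 0 - t * chi 0 = (chi c - chi 0) * t by move: H; lra.
  rewrite normrM (ger0_norm t0) -[leRHS]mulr1.
  by apply: ler_pM => //; apply: Bchi; rewrite c0 (le_trans ct).
pose h (s : R) := phi s - s * psi 0 - s ^+ 2 * (chi 0 / 2).
have hd (s : R) : 0 <= s <= 1 -> is_derive s 1 h (psi s - psi 0 - s * chi 0).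
  move=> s01; have := dphi s s01 => dph.
  by apply: is_derive_eq; rewrite /GRing.scale /=; field.
have [|c] := @MVT_segment R h (fun s => psi s - psi 0 - s * chi 0) 0 1 ler01 _
  (derive_cts _ _ _ (lexx 1) hd).
  by move=> s; rewrite in_itv /= => /andP[/ltW s0 /ltW s1]; apply: hd; rewrite s0.
rewrite in_itv /= /h => c01 H.
have -> : phi 1 - phi 0 - psi 0 - chi 0 / 2 = psi c - psi 0 - c * chi 0.
  by move: H; rewrite expr1n expr0n /=; lra.
exact: psi_bound.
Qed.

Lemma C2_taylor (U : set X) (g : X -> R) D1 D2 (x u : X) (e : R) :
  C2_on U g D1 D2 -> (forall t : R, 0 <= t <= 1 -> U (x + t *: u)) ->
  (forall t : R, 0 <= t <= 1 -> `|D2 (x + t *: u) - D2 x| <= e) ->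
  `|g (x + u) - g x - diagonal u (D1 x) - diagonal u (D2 x) / 2| <= e * `|u| ^+ 2.
Proof.
move=> C2 Uxu D2e.
pose phi (t : R) := g (x + t *: u); pose psi (t : R) := diagonal u (D1 (x + t *: u)).
pose chi (t : R) := diagonal u (D2 (x + t *: u)).
have := @taylor2_bound phi psi chi (e * `|u| ^+ 2).
rewrite /phi /psi /chi scale1r !scale0r !addr0; apply => t t01.
- have [dg gE _ _ _] := C2 _ (Uxu t t01).
  by rewrite -[diagonal _ _]gE; exact: is_derive_line.
- have [_ _ dD1 D1E _] := C2 _ (Uxu t t01).
  have dd : is_diff (D1 (x + t *: u)) (@diagonal 1 u : _ -> R^o) (@diagonal 1 u).
    apply: DiffDef; first by apply: linear_differentiable; exact: diagonal_continuous.
    by rewrite diff_lin //; exact: diagonal_continuous.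
  have dc := is_diff_comp (differentiableP dD1) dd.
  have H := is_derive_line (@ex_diff _ _ _ _ _ _ _ dc).
  apply: (is_derive_eq H); rewrite (@diff_val _ _ _ _ _ _ _ dc) /= D1E /diagonal /=.
  congr (D2 _ _); apply/funext => i; rewrite /contr_arg.
  by case: fintype.split.
- rewrite -[X in `|X|](linearB (@diagonal 2 u)) .
  apply: le_trans (diagonal_le _ _) _; rewrite ler_wpM2r ?exprn_ge0 //.
  exact: D2e.
Qed.
End Diagonal.

(** * Walks with equal covariances *)

Section Update.
Variables (R : realType) (I T : finType).

Definition update (c : {ffun I -> T}) i t : {ffun I -> T} :=
  [ffun j => if j == i then t else c j].

Lemma avg_pair (A B : finType) (F : A -> B -> R) :
  avg (fun p => F p.1 p.2) = avg (fun a => avg (F a)).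
Proof.
by rewrite /avg -mulr_suml pair_bigA card_prod natrM invfM /= mulrA mulrAC.
Qed.

(** Resampling one coordinate preserves the uniform distribution: exchanging [c i] with the new
    value [t] is an involution on pairs. *)
Lemma avg_update (F : {ffun I -> T} -> R) i : (0 < #|T|)%N ->
  avg F = avg (fun c => avg (fun t => F (update c i t))).
Proof.
move=> T0; rewrite -(avg_pair (fun c t => F (update c i t))).
pose h (p : {ffun I -> T} * T) := (update p.1 i p.2, p.1 i).
have hh : involutive h.
  move=> [c t]; rewrite /h /= ffunE eqxx; congr (_, _); apply/ffunP => j.
  by rewrite !ffunE; case: eqP => [->|].
rewrite [RHS](avg_bij (fun p => F p.1) (inv_bij hh)) (avg_pair (fun c (_ : T) => F c)).
by apply: eq_avg => c; rewrite avg_cst.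
Qed.
End Update.

(* The steps [±5 v0, ±5 v1] (for [l = false]) and [±(3 v0 + 4 v1)],
   [±(4 v0 - 3 v1)] (for [l = true]), equidistributed, have the same first and
   second moments. *)
Definition stage_coef (l : bool) (c : bool * bool) (b : bool) : int :=
  (-1) ^+ c.1 * (if l then (if c.2 then (if b then -3 else 4) else (if b then 4 else 3))
                 else (if c.2 == b then 5 else 0)).

Lemma stage_coef_le l c b : `|stage_coef l c b| <= 5.
Proof. by case: l c b => [] [[] []] []. Qed.

Lemma stage_coefB_le c c' b : `|stage_coef false c b - stage_coef true c' b| <= 9.
Proof. by case: c c' b => [[] []] [[] []] []. Qed.

(** The values [0, ±5] never meet [±3, ±4]. Hence endpoints of the two walks differ in every
    coordinate, as the lower bound of the net requires. *)
Lemma stage_coefB_neq0 c c' b : stage_coef false c b - stage_coef true c' b != 0.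
Proof. by case: c c' b => [[] []] [[] []] []. Qed.

(** * Comparison of the two walks, stage by stage *)

Section Stages.
Variables (R : realType) (X : normedModType R).

Lemma scalar_at0 (f : X -> R) : scalar f -> f 0 = 0.
Proof.
move=> /(_ 1 0 0); rewrite scaler0 addr0 mul1r => /eqP.
by rewrite -subr_eq0 opprD addrA subrr sub0r oppr_eq0 => /eqP.
Qed.

Lemma diagonal1_expand (N : mform X 1) (v : bool -> X) : exists A B : R,
  forall a b : R, diagonal (a *: v false + b *: v true) N = a * A + b * B.
Proof.
have [lN _] := mformP N.
have E x : N (fun=> x) = N (mathcomp_extra.dfwith (fun _ : 'I_1 => 0 : X) ord0 x).
  congr (N _); apply/funext => i; rewrite (_ : i = ord0) ?mathcomp_extra.dfwithin //; exact: ord1.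
exists (N (fun=> v false)), (N (fun=> v true)) => a b.
rewrite /diagonal !E lN -[b *: v true]addr0 lN; congr (_ + _).
by rewrite (scalar_at0 (lN ord0 (fun=> 0))) addr0.
Qed.

Lemma diagonal2_expand (N : mform X 2) (v : bool -> X) : exists A B C : R,
  forall a b : R, diagonal (a *: v false + b *: v true) N =
    a ^+ 2 * A + a * b * B + b ^+ 2 * C.
Proof.
have [lN _] := mformP N.
pose M p q := N (fun i : 'I_2 => if i == ord0 then p else q).
have M0 q : scalar (M^~ q).
  move=> a x y; have := lN ord0 (fun=> q) a x y.
  have E z : N (mathcomp_extra.dfwith (fun _ : 'I_2 => q) ord0 z) = M z q.
    congr (N _); apply/funext => i; case: (eqVneq i ord0) => [->|i0].
      by rewrite mathcomp_extra.dfwithin.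
    by rewrite mathcomp_extra.dfwithout // eq_sym.
  by rewrite !E.
have M1 p : scalar (M p).
  move=> a x y; have := lN ord_max (fun=> p) a x y.
  have E z : N (mathcomp_extra.dfwith (fun _ : 'I_2 => p) ord_max z) = M p z.
    congr (N _); apply/funext => i; case: (eqVneq i ord0) => [->|i0].
      by rewrite mathcomp_extra.dfwithout.
    have -> : i = ord_max by apply/val_inj; case: i i0 => [[|[|]]].
    by rewrite mathcomp_extra.dfwithin.
  by rewrite !E.
have M00 q : M 0 q = 0.
  exact: scalar_at0 (M0 q).
have M10 p : M p 0 = 0.
  exact: scalar_at0 (M1 p).
exists (M (v false) (v false)), (M (v false) (v true) + M (v true) (v false)),
  (M (v true) (v true)) => a b.
have -> : diagonal (a *: v false + b *: v true) N =
    M (a *: v false + b *: v true) (a *: v false + b *: v true).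
  by congr (N _); apply/funext => i; case: ifP.
rewrite M0 M1 -[b *: v true]addr0 !(M0, M1) !(M00, M10); ring.
Qed.

Definition stage_step (v : bool -> X) l c : X := \sum_b (stage_coef l c b)%:~R *: v b.

Lemma stage_stepE v l c : stage_step v l c =
  (stage_coef l c false)%:~R *: v false + (stage_coef l c true)%:~R *: v true.
Proof. by rewrite /stage_step big_bool /= addrC. Qed.

(** The first and second order terms have equal averages for both kinds of steps, so only the two
    Taylor remainders contribute. *)
Lemma stage_compare (F : X -> R) (N1 : mform X 1) (N2 : mform X 2) (v : bool -> X)
    (z : X) (K : R) :
  (forall l c, let u := stage_step v l c in
    `|F (z + u) - F z - diagonal u N1 - diagonal u N2 / 2| <= K) ->
  `|avg (fun c => F (z + stage_step v false c)) -
    avg (fun c => F (z + stage_step v true c))| <= 2 * K.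
Proof.
move=> FK.
pose E l c := let u := stage_step v l c in
  F (z + u) - F z - diagonal u N1 - diagonal u N2 / 2.
have avgE l : `|avg (E l)| <= K.
  apply: le_trans (normr_avg_le _) _.
  rewrite -[leRHS](@avg_cst R (bool * bool)%type) ?card_prod ?card_bool //.
  by apply: le_avg => c; exact: FK.
suff -> : avg (fun c => F (z + stage_step v false c)) -
    avg (fun c => F (z + stage_step v true c)) = avg (E false) - avg (E true).
  by apply: le_trans (ler_normB _ _) _; have := avgE false; have := avgE true; lra.
have [A [B AB]] := diagonal1_expand N1 v.
have [A2 [B2 [C2 ABC]]] := diagonal2_expand N2 v.
have Ef l c : F (z + stage_step v l c) = E l c + (F z + (diagonal (stage_step v l c) N1 +
   diagonal (stage_step v l c) N2 / 2)) by rewrite /E /=; ring.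
under eq_avg do rewrite Ef stage_stepE AB ABC.
under [X in _ - X]eq_avg do rewrite Ef stage_stepE AB ABC.
rewrite !(avgD (E _)) opprD addrACA -[RHS]addr0; congr (_ + _).
have avg4 (G : bool * bool -> R) : avg G =
    (G (true, true) + G (true, false) + (G (false, true) + G (false, false))) / 4.
  rewrite /avg card_prod card_bool; congr (_ / _).
  transitivity (\sum_a \sum_b G (a, b)); last by rewrite !big_bool.
  by rewrite pair_bigA; apply: eq_bigr => -[].
rewrite !avg4 /stage_coef /= !expr1 !expr0 !mulN1r !mul1r; by field.
Qed.

Variables (m : nat) (v : 'I_m * bool -> X).

Definition walk (a : 'I_m * bool -> int) : X := \sum_p (a p)%:~R *: v p.

(** The first [k] stages use the rotated steps, the others the axial ones; [k = 0] and [k = m] give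
    the two walks. *)
Definition hybrid (k : nat) (c : {ffun 'I_m -> bool * bool}) (p : 'I_m * bool) : int :=
  stage_coef (p.1 < k)%N (c p.1) p.2.

Definition hybrid_hole (i : 'I_m) c p : int := if p.1 == i then 0 else hybrid i c p.

Lemma walkE a : walk a = \sum_j \sum_b (a (j, b))%:~R *: v (j, b).
Proof. by rewrite pair_bigA; apply: eq_bigr => -[]. Qed.

Lemma walkB a a' : walk a - walk a' = walk (fun p => a p - a' p).
Proof. by rewrite /walk -sumrB; apply: eq_bigr => p _; rewrite rmorphB scalerBl. Qed.

Lemma walk_hybrid_update (l : bool) (i : 'I_m) c t : walk (hybrid (i + l) (update c i t)) =
  walk (hybrid_hole i c) + stage_step (fun b => v (i, b)) l t.
Proof.
rewrite !walkE (bigD1 i) //= [in RHS](bigD1 i) //= addrC.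
have -> : \sum_b (hybrid_hole i c (i, b))%:~R *: v (i, b) = 0.
  by apply: big1 => b _; rewrite /hybrid_hole eqxx scale0r.
rewrite add0r; congr (_ + _).
  apply: eq_bigr => j ji; apply: eq_bigr => b _; congr (_%:~R *: _).
  rewrite /hybrid_hole /hybrid ffunE /= (negbTE ji); congr stage_coef.
  by case: l => /=; rewrite ?addn0 // addn1 ltnS leq_eqVlt (inj_eq val_inj) (negbTE ji).
apply: eq_bigr => b _; congr (_%:~R *: _).
rewrite /hybrid ffunE eqxx /=; congr stage_coef.
by case: l => /=; rewrite ?addn0 ?ltnn // addn1 ltnSn.
Qed.

Lemma hybrid_le k c p : `|hybrid k c p| <= 9.
Proof. exact: le_trans (stage_coef_le _ _ _) _. Qed.

Lemma hybrid_hole_le i c p : `|hybrid_hole i c p| <= 9.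
Proof. by rewrite /hybrid_hole; case: ifP => // _; exact: hybrid_le. Qed.

Lemma stage_step_le (gam : R) i l t : (forall p, `|v p| <= gam) ->
  `|stage_step (fun b => v (i, b)) l t| <= 10 * gam.
Proof.
move=> vg; rewrite stage_stepE; apply: le_trans (ler_normD _ _) _; rewrite !normrZ.
have coef b : `|(stage_coef l t b)%:~R : R| <= 5.
  by rewrite -intr_norm (ler_int R _ 5) stage_coef_le.
have H b : `|(stage_coef l t b)%:~R : R| * `|v (i, b)| <= 5 * gam by apply: ler_pM.
by have := H false; have := H true; lra.
Qed.

Lemma ball0_segment (r : R) (x u : X) (t : R) : ball 0 r x -> ball 0 r (x + u) ->
  0 <= t <= 1 -> ball 0 r (x + t *: u).
Proof.
rewrite -ball_normE /= !sub0r !normrN => xr xur /andP[t0 t1].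
have -> : x + t *: u = (1 - t) *: x + t *: (x + u).
  by rewrite scalerDr addrA -scalerDl subrK scale1r.
apply: le_lt_trans (ler_normD _ _) _; rewrite !normrZ !ger0_norm ?subr_ge0 //.
have [->|tn] := eqVneq t 0; first by rewrite subr0 mul1r mul0r addr0.
have : t * `|x + u| < t * r by rewrite ltr_pM2l // lt_def tn.
have : (1 - t) * `|x| <= (1 - t) * r by rewrite ler_wpM2l ?subr_ge0 // ltW.
lra.
Qed.

(** Lindeberg's replacement argument: consecutive hybrids differ in one stage. With the other stages
    fixed, that stage is compared from the common point [w c], and the differences telescope. *)
Lemma walk_compare (f : X -> R) D1 D2 (r e d gam : R) (z : X) : 0 <= e ->
  C2_on (ball 0 r) f D1 D2 ->
  (forall x y, ball 0 r x -> ball 0 r y -> `|x - y| < d -> `|D2 x - D2 y| < e) ->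
  (forall a, (forall p, `|a p| <= 9) -> ball 0 r (z + walk a)) ->
  (forall p, `|v p| <= gam) -> 10 * gam < d ->
  `|avg (fun c => f (z + walk (hybrid 0 c))) - avg (fun c => f (z + walk (hybrid m c)))|
    <= m%:R * (2 * (e * (10 * gam) ^+ 2)).
Proof.
move=> e0 C2 unif inU vg gd.
pose A k := avg (fun c => f (z + walk (hybrid k c))).
have step (i : 'I_m) : `|A i - A i.+1| <= 2 * (e * (10 * gam) ^+ 2).
  rewrite /A [X in `|X - _|](avg_update _ i) ?card_prod ?card_bool //.
  rewrite [X in `|_ - X|](avg_update _ i) ?card_prod ?card_bool //.
  set K := _ * (_ ^+ 2); pose w c := z + walk (hybrid_hole i c).
  have -> : avg (fun c => avg (fun t => f (z + walk (hybrid i (update c i t))))) =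
      avg (fun c => avg (fun t => f (w c + stage_step (fun b => v (i, b)) false t))).
    apply: eq_avg => c; apply: eq_avg => t.
    by rewrite -addrA -walk_hybrid_update addn0.
  have -> : avg (fun c => avg (fun t => f (z + walk (hybrid i.+1 (update c i t))))) =
      avg (fun c => avg (fun t => f (w c + stage_step (fun b => v (i, b)) true t))).
    apply: eq_avg => c; apply: eq_avg => t.
    by rewrite -addrA -walk_hybrid_update addn1.
  rewrite -[X in _ - X]mul1r -mulNr -avgZ -avgD.
  apply: le_trans (normr_avg_le _) _.
  rewrite -[leRHS](avg_cst _ (_ : 0 < #|{ffun 'I_m -> bool * bool}|)%N); last first.
    by apply/card_gt0P; exists [ffun=> (true, true)].
  apply: le_avg => c; rewrite mulN1r.
  apply: (@stage_compare f (D1 (w c)) (D2 (w c))) => l t /=; set u := stage_step _ _ _.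
  have wU : ball 0 r (w c) by apply: inU => p; exact: hybrid_hole_le.
  have wuU : ball 0 r (w c + u).
    by rewrite /w -addrA -walk_hybrid_update; apply: inU => p; exact: hybrid_le.
  have u10 : `|u| <= 10 * gam by exact: stage_step_le.
  apply: (@le_trans _ _ (e * `|u| ^+ 2)); last first.
    by rewrite ler_wpM2l // ler_pXn2r // ?nnegrE // (le_trans (normr_ge0 _) u10).
  have seg s : 0 <= s <= 1 -> ball 0 r (w c + s *: u) by exact: ball0_segment.
  apply: (C2_taylor C2 seg) => s s01; apply/ltW/unif => //; first exact: seg.
  rewrite addrAC subrr add0r normrZ; apply: le_lt_trans gd; apply: le_trans u10.
  by rewrite ler_piMl //; case/andP: s01 => s0 s1; rewrite ger0_norm.
have -> : avg (fun c => f (z + walk (hybrid 0 c))) -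
    avg (fun c => f (z + walk (hybrid m c))) = \sum_(i < m) (A i - A i.+1).
  rewrite -(big_mkord xpredT (fun i => A i - A i.+1)) (telescope_sumr_eq (fun k => - A k)) //.
    by rewrite opprK addrC.
  by move=> k _; rewrite opprK addrC.
apply: le_trans (ler_norm_sum _ _ _) _; apply: le_trans (ler_sum _ (fun i _ => step i)) _.
by rewrite sumr_const card_ord -[_ *+ m]mulr_natl.
Qed.

End Stages.

(** * The counterexample *)

Section LocallyConstant.
Variables (R : realType) (X : normedModType R).

Lemma cst_form_subproof (a : R) : (fun _ : 'I_0 -> X => a) \in @mform_pred R X 0.
Proof. by apply/asboolP; split=> [[]|] //; exact: cst_continuous. Qed.

Definition cst_form (a : R) : mform X 0 := MForm (cst_form_subproof a).

Lemma norm_cst_form (a : R) : `|cst_form a| <= `|a|.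
Proof. exact: mnorm_le. Qed.

Lemma contr0 j l (u : X) : contr u (0 : mform X (j + l)) = 0.
Proof. exact/val_inj/funext. Qed.

Definition cst_jet (f : X -> R) j (x : X) : mform X j :=
  match j with 0%N => cst_form (f x) | _ => 0 end.

Lemma taylor_remainder_cst_jet (f : X -> R) k j x y :
  cst_jet f j y - \sum_(l < (k - j).+1)
    (l`!%:R)^-1 *: contr (y - x) (cst_jet f (j + l)%N x) =
  match j with 0%N => cst_form (f y - f x) | _ => 0 end.
Proof.
case: j => [|j].
  rewrite big_ord_recl big1 => [|l _]; last by rewrite /= contr0 scaler0.
  rewrite addr0 /= invr1 scale1r; apply/val_inj/funext => w; exact.
by rewrite big1 ?subr0 // => l _; rewrite /= contr0 scaler0.
Qed.

(** With zero derivatives, the only nonzero remainders occur for [j = 0] at points where [f]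
    differs; these are at distance at least [s]. *)
Lemma W_cond_locally_constant (E : set X) (f : X -> R) (s : R) (k : nat)
    (omega : R -> \bar R) : 0 < s -> (forall x y, `|f y - f x| <= 1) ->
  (forall x y, E x -> E y -> f x != f y -> s <= `|y - x|) ->
  nontrivial_modulus omega ->
  exists M : R, 0 < M /\ W_cond k (fun t => (M%:E * omega t)%E) E f.
Proof.
move=> s0 f1 fs [[_ omega0 omega_nd _] omega_gt0].
(* The value [omega s] may be infinite, hence a finite positive lower bound. *)
have [w w0 wE] : exists2 w : R, 0 < w & (w%:E <= omega s)%E.
  case: (omega s) (omega_gt0 s s0) => [w|_|//]; first by exists w.
  by exists 1 => //; exact: leey.
(* With this [M] the bound at distance [s] is at least 1. *)
have M0 : 0 < k`!%:R / (w * s ^+ k) :> R.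
  by rewrite divr_gt0 ?ltr0n ?fact_gt0 // mulr_gt0 // exprn_gt0.
exists (k`!%:R / (w * s ^+ k)); split=> //; set M := _ / _ in M0 *.
exists (fun j => cst_jet f j); split=> [//|j x jk Ex sg v|j x y jk Ex Ey /=].
  by case: j jk sg v => //= j jk sg v; rewrite [LHS]/(f x).
rewrite taylor_remainder_cst_jet.
have rhs_ge0 (t : X) :
    (0 <= ((k - j)`!%:R^-1)%:E * (M%:E * omega `|t|%R) * (`|t| ^+ (k - j))%:E)%E.
  rewrite !mule_ge0 ?lee_fin ?invr_ge0 ?ler0n ?exprn_ge0 ?(ltW M0) //.
  exact: omega0.
case: j jk rhs_ge0 => [|j] jk rhs_ge0; last by rewrite normr0; exact: rhs_ge0.
have [fxy|fxy] := eqVneq (f x) (f y).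
  apply: le_trans (rhs_ge0 _); rewrite lee_fin; apply: le_trans (norm_cst_form _) _.
  by rewrite fxy subrr normr0.
have sxy := fs x y Ex Ey fxy.
apply: (@le_trans _ _ 1%:E).
  by rewrite lee_fin (le_trans (norm_cst_form _)).
rewrite subn0; apply: (@le_trans _ _ ((k`!%:R^-1)%:E * (M%:E * w%:E) * (s ^+ k)%:E)%E).
  rewrite -!EFinM lee_fin /M le_eqVlt; apply/orP; left; apply/eqP; field.
  by rewrite !gt_eqF ?exprn_gt0 ?ltr0n ?fact_gt0.
apply: lee_pmul.
- by rewrite !mule_ge0 ?lee_fin ?invr_ge0 ?ler0n ?(ltW M0) ?(ltW w0).
- by rewrite lee_fin exprn_ge0 // ltW.
- rewrite lee_pmul2l ?lte_fin ?invr_gt0 ?ltr0n ?fact_gt0 //.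
  rewrite lee_pmul2l // ?lte_fin //; apply: le_trans wE _.
  by apply: omega_nd => //; exact: ltW.
- by rewrite lee_fin lerXn2r ?nnegrE ?(ltW s0) ?normr_ge0.
Qed.

(** A ball of radius [s / 2] meets at most one of the sets, so a point of the closure of the union
    is in the closure of one of them. *)
Lemma closed_bigcup_separated (F : nat -> set X) (s : R) : 0 < s ->
  (forall n, closed (F n)) ->
  (forall n m x y, n != m -> F n x -> F m y -> s <= `|x - y|) ->
  closed (\bigcup_n F n).
Proof.
move=> s0 cF sepF x clx.
have s2 : 0 < s / 2 by rewrite divr_gt0.
have [y [[n _ Fy] xy]] := clx _ (nbhsx_ballx x _ s2).
exists n => //; apply: cF => A Ax.
have [y' [[m _ Fy'] [xy' Ay']]] := clx _ (filterI (nbhsx_ballx x _ s2) Ax).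
exists y'; split=> //; have [-> //|nm] := eqVneq n m.
have := sepF _ _ _ _ nm Fy Fy'; rewrite leNgt => /negP; case.
rewrite -(subrK x y) -addrA; apply: le_lt_trans (ler_normD _ _) _.
by move: xy xy'; rewrite -ball_normE /= distrC; lra.
Qed.

End LocallyConstant.

(** * The blocks, their labels and the absence of an extension *)

Section Construction.
Variables (R : realType) (X : normedModType R).
Variables (e : nat -> X) (g : forall n, 'I_n.+1 * bool -> X).
Hypothesis eP : forall n, `|e n| = 1 /\ separated_from e n (e n).
Hypothesis g_le : forall n j, `|@g n j| ^+ 2 <= 41 / (n.+1 * 2)%:R.
Hypothesis g_comb : forall n (a : 'I_n.+1 * bool -> int), (forall j, `|a j| <= 9) ->
  `|\sum_j (a j)%:~R *: g j| <= 10 /\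
  ((forall j, a j != 0) -> 2^-1 <= `|\sum_j (a j)%:~R *: g j|).

(** The factor 1/160 confines each walk to radius [10/160 = 1/16], while the centres [2^-1 *: e n]
    are at mutual distance at least 1/4. *)
Definition block_vector n (j : 'I_n.+1 * bool) : X := 160^-1 *: g j.

Definition block_point n (l : bool) (c : {ffun 'I_n.+1 -> bool * bool}) : X :=
  2^-1 *: e n + walk (@block_vector n) (hybrid (if l then n.+1 else 0%N) c).

Definition block n : set X := [set x | exists l c, x = @block_point n l c].

Definition label (x : X) : R := `[< exists n c, x = @block_point n true c >]%:R.

Lemma separated_dist n p : n != p -> 2^-1 <= `|e n - e p|.
Proof.
have H i k : (i < k)%N -> 2^-1 <= `|e k - e i|.
  move=> ik; have := proj2 (eP k) (fun j => (j == i)%:R).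
  rewrite (bigD1 (Ordinal ik)) //= eqxx scale1r big1 ?addr0 // => j ji.
  by rewrite -[j == i :> nat]/(j == Ordinal ik) (negbTE ji) scale0r.
by case: ltngtP => // [/H|/H //]; rewrite distrC.
Qed.

Lemma norm_block_walk n a : `|walk (@block_vector n) a| = 160^-1 * `|\sum_j (a j)%:~R *: g j|.
Proof.
rewrite -[160^-1 in RHS]gtr0_norm ?invr_gt0 // -normrZ scaler_sumr; congr (`|_|).
by apply: eq_bigr => j _; rewrite /block_vector !scalerA mulrC.
Qed.

Lemma block_walk_le n a : (forall j, `|a j| <= 9) -> `|walk (@block_vector n) a| <= 1 / 16.
Proof. by move=> /g_comb[H _]; rewrite norm_block_walk; lra. Qed.

Lemma block_label_separated n c c' :
  1 / 320 <= `|@block_point n false c - @block_point n true c'|.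
Proof.
rewrite /block_point opprD addrACA subrr add0r walkB norm_block_walk.
have E p : hybrid 0 c p - hybrid n.+1 c' p =
    stage_coef false (c p.1) p.2 - stage_coef true (c' p.1) p.2.
  by rewrite /hybrid ltn0 ltn_ord.
have [|_ H] := @g_comb n (fun p => hybrid 0 c p - hybrid n.+1 c' p).
  by move=> p; rewrite E stage_coefB_le.
suff : 2^-1 <= `|\sum_j (hybrid 0 c j - hybrid n.+1 c' j)%:~R *: g j| by lra.
by apply: H => p; rewrite E stage_coefB_neq0.
Qed.

Lemma block_separated n p x y : n != p -> block n x -> block p y -> 1 / 8 <= `|x - y|.
Proof.
move=> np [l [c ->]] [l' [c' ->]].
rewrite /block_point; set u := walk _ _; set u' := walk (@block_vector p) _.
have u16 : `|u| <= 1 / 16 by apply: block_walk_le => j; exact: hybrid_le.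
have u16' : `|u'| <= 1 / 16 by apply: block_walk_le => j; exact: hybrid_le.
have := separated_dist np.
have -> : e n - e p = 2 *: ((2^-1 *: e n + u) - (2^-1 *: e p + u') - (u - u')).
  rewrite (opprD (2^-1 *: e p)) (addrACA (2^-1 *: e n)) addrK.
  by rewrite scalerBr !scalerA divff // !scale1r.
rewrite normrZ gtr0_norm // => H.
have := ler_normB (2^-1 *: e n + u - (2^-1 *: e p + u')) (u - u').
have := ler_normB u u'; lra.
Qed.

Lemma block_finite n : finite_set (block n).
Proof.
have -> : block n = (fun p : bool * {ffun 'I_n.+1 -> bool * bool} =>
    @block_point n p.1 p.2) @` setT.
  apply/seteqP; split=> [x [l [c ->]]|x [[l c] _ <-]]; last by exists l, c.
  by exists (l, c).
exact/finite_image/finite_finset.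
Qed.

Lemma block_union_closed : closed (\bigcup_n block n).
Proof.
have T1 : accessible_space X by exact/hausdorff_accessible/norm_hausdorff.
apply: (@closed_bigcup_separated _ _ _ (1 / 8)) => [|n|]; first lra.
  by apply: (proj1 (@accessible_finite_set_closed X) T1); exact: block_finite.
exact: block_separated.
Qed.

Lemma label_true n c : label (@block_point n true c) = 1.
Proof. by rewrite /label asboolT //; exists n, c. Qed.

Lemma label_false n c : label (@block_point n false c) = 0.
Proof.
rewrite /label asboolF // => -[p [c' H]].
have [np|np] := eqVneq n p.
  move: c' H; rewrite -np => c' H; have := @block_label_separated n c c'.
  by rewrite H subrr normr0; lra.
have := @block_separated n p _ _ np (ex_intro _ false (ex_intro _ c erefl))
  (ex_intro _ true (ex_intro _ c' erefl)).
by rewrite H subrr normr0; lra.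
Qed.

Lemma block_union_label_separated x y : (\bigcup_n block n) x -> (\bigcup_n block n) y ->
  label x != label y -> 1 / 320 <= `|y - x|.
Proof.
move=> [n _ nx] [p _ py]; have [np|np] := eqVneq n p; last first.
  by have := block_separated np nx py; rewrite distrC; lra.
move: py nx; rewrite -np => -[l [c ->]] [l' [c' ->]].
case: l l' => [] []; rewrite ?label_true ?label_false ?eqxx // => _.
  by rewrite distrC block_label_separated.
exact: block_label_separated.
Qed.

Lemma block_union_unit_ball : \bigcup_n block n `<=` [set x : X | `|x| <= 1].
Proof.
move=> _ [n _ [l [c ->]]] /=; apply: le_trans (ler_normD _ _) _.
have := @block_walk_le n (hybrid (if l then n.+1 else 0%N) c).
move=> /(_ (fun=> hybrid_le _ _ _)).
rewrite normrZ (proj1 (eP n)) gtr0_norm ?invr_gt0 //; lra.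
Qed.

Lemma label_no_extension (r : R) : 1 < r ->
  ~ exists h : X -> R, (forall x, (\bigcup_n block n) x -> h x = label x) /\
    C2plus (ball (0 : X) r) h.
Proof.
move=> r1 [h [hE [D1 [D2 [C2 unif]]]]].
have half0 : 0 < 2^-1 :> R by rewrite invr_gt0.
have [d d0 dP] := unif _ half0.
(* Many stages make the steps short: [(10 * gam)^2] is less than [1/(n+1)], hence less than
   [d^2]. *)
have [n _ nd] := near_infty_natSinv_lt (PosNum (exprn_gt0 2 d0)).
pose gam : R := Num.sqrt (41 / (n.+1 * 2)%:R) / 160.
have gam0 : 0 <= gam by rewrite divr_ge0 ?sqrtr_ge0.
have gam2 : gam ^+ 2 = 41 / (n.+1 * 2)%:R * 160^-1 ^+ 2.
  by rewrite /gam exprMn sqr_sqrtr ?divr_ge0.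
have lab l : avg (fun c => h (2^-1 *: e n +
    walk (@block_vector n) (hybrid (if l then n.+1 else 0%N) c))) = l%:R.
  rewrite -[RHS](@avg_cst R {ffun 'I_n.+1 -> bool * bool}); last first.
    by apply/card_gt0P; exists [ffun=> (true, true)].
  apply: eq_avg => c; rewrite hE; last by exists n => //; exists l, c.
  by case: l; rewrite -/(block_point _ _) ?label_true ?label_false.
have : `|false%:R - true%:R| <= n.+1%:R * (2 * (2^-1 * (10 * gam) ^+ 2)) :> R.
  rewrite -(lab false) -(lab true).
  apply: (walk_compare (ltW half0) C2 dP) => [|p|].
  - move=> a a9; rewrite -ball_normE /= sub0r normrN.
    apply: le_lt_trans r1; apply: le_trans (ler_normD _ _) _.
    rewrite normrZ (proj1 (eP n)) gtr0_norm ?invr_gt0 //.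
    by have := block_walk_le a9; lra.
  - rewrite -(ler_pXn2r (ltn0Sn 1)) ?nnegrE // gam2 normrZ exprMn.
    by rewrite gtr0_norm ?invr_gt0 // mulrC ler_wpM2r ?exprn_ge0 ?invr_ge0.
  - rewrite -(ltr_pXn2r (ltn0Sn 1)) ?nnegrE ?mulr_ge0 ?(ltW d0) // exprMn gam2.
    have := exprn_gt0 2 d0; have /= := nd n (leqnn n); rewrite natrM invfM.
    move: (n.+1%:R^-1) => w; lra.
(* The averages 0 and 1 differ by 1, but the bound is [50 * 41 / 160^2 < 1], independently of
   [n]. *)
rewrite sub0r normrN normr1 exprMn gam2 natrM invfM.
have : n.+1%:R * n.+1%:R^-1 = 1 :> R by rewrite divff.
move: (n.+1%:R) (n.+1%:R^-1) => w w'; lra.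
Qed.

End Construction.

Theorem corollary14 (R : realType) (X : completeNormedModType R)
    (hX : infinite_dim X) :
  exists (E : set X) (f : X -> R),
  [/\ closed E,
      E `<=` [set x : X | `|x| <= 1],
      forall (k : nat) (omega : R -> \bar R),
        (0 < k)%N -> nontrivial_modulus omega ->
        exists M : R,
          0 < M /\ W_cond k (fun t => (M%:E * omega t)%E) E f &
      forall r : R, 1 < r ->
        ~ exists g : X -> R,
            (forall x, E x -> g x = f x) /\ C2plus (ball (0 : X) r) g].
Proof.
have [e eP] := separated_sequence hX.
have cardJ n : #|{: 'I_n.+1 * bool}| = (n.+1 * 2)%N by rewrite card_prod card_ord card_bool.
have J0 n : (0 < #|{: 'I_n.+1 * bool}|)%N by rewrite cardJ.
have netP n := l2_almost_isometric_net hX (J0 n).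
pose g n := sval (cid (netP n)).
exists (\bigcup_n block e g n), (label e g).
have g_le n j : `|@g n j| ^+ 2 <= 41 / (n.+1 * 2)%:R.
  by rewrite -cardJ /g; case: cid => /= g' [].
have g_comb n := proj2 (svalP (cid (netP n))).
split.
- exact: (block_union_closed eP g_comb).
- exact: (block_union_unit_ball eP g_comb).
- move=> k omega _ omegaP; have c0 : 0 < 1 / 320 :> R by lra.
  apply: (W_cond_locally_constant k c0 _ _ omegaP).
  + move=> x y; rewrite /label; do 2![case: asboolP => _];
    by rewrite ?subrr ?subr0 ?sub0r ?normrN ?normr0 ?normr1.
  + exact: (block_union_label_separated eP g_comb).
- exact: (label_no_extension eP g_le g_comb).
Qed.
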